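(* Let $q,\rho_{12},\rho_{13},\rho_{23}\in(-1,1)$ and $r=\rho_{12}\rho_{13}\rho_{23}$. Let $f_X,f_Y,f_Z$ be the one-dimensional marginal densities of the density $f_{3D}(x,y,z|\rho_{12},\rho_{13},\rho_{23},q)$ defined in the context. Then the densities $f_Z(z|\rho_{12},\rho_{13},\rho_{23},q)$, $f_Y$ and $f_X$ (each written as a function of $z\in S(q)$) are of one of the following equivalent forms: $$(1-r)f_N(z|q)\sum_{j\ge0}\frac{r^j}{[j]_q!}H_j^2(z|q)=(1-r)f_{CN}(z|z,r,q)$$ $$=(1-r)f_N(z|q)\frac{(r^2)_\infty}{(r)_\infty^2\prod_{i=0}^\infty l_q(z|rq^i)}$$ $$=(1-r)f_N(z|q)\sum_{k=0}^\infty\frac{r^k}{[k]_q!(r)_{k+1}}H_{2k}(z|q)$$ $$=\frac{2(1+r)\sqrt{4-(1-q)z^2}\,(q)_\infty(r^2q)_\infty}{\pi\, l_q(z|r)(rq)_\infty^2}\prod_{j=1}^\infty\frac{l_q(z|q^j)}{l_q(z|rq^j)}.$$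
   Context: For $|q|<1$ let $S(q)=[-2/\sqrt{1-q},2/\sqrt{1-q}]$, $[0]_q=0$, $[n]_q=1+q+\dots+q^{n-1}$ for $n\ge1$, $[0]_q!=1$, $[n]_q!=\prod_{i=1}^n[i]_q$ for $n\ge1$; $(a)_j=\prod_{k=1}^j(1-aq^{k-1})$ for $j\ge1$, $(a)_\infty=\prod_{k=0}^\infty(1-aq^k)$. Define $$l_q(x|a)=(1+a)^2-(1-q)ax^2,\qquad \omega_q(x,y|\rho)=(1-\rho^2)^2-(1-q)xy\rho(1+\rho^2)+(1-q)\rho^2(x^2+y^2),$$ $$f_N(x|q)=\frac{(q)_\infty\sqrt{1-q}\sqrt{4-(1-q)x^2}}{2\pi}\prod_{i=1}^\infty l_q(x|q^i),\qquad f_{CN}(x|y,\rho,q)=f_N(x|q)\frac{(\rho^2)_\infty}{\prod_{i=0}^\infty\omega_q(x,y|\rho q^i)}.$$ The three-dimensional density is, for $x,y,z\in S(q)$, $$f_{3D}(x,y,z|\rho_{12},\rho_{13},\rho_{23},q)=f_N(x|q)f_N(y|q)f_N(z|q)\frac{C_{3D}(\rho_{12}^2)_\infty(\rho_{13}^2)_\infty(\rho_{23}^2)_\infty}{\prod_{i=0}^\infty\left(\omega_q(x,y|\rho_{12}q^i)\,\omega_q(x,z|\rho_{13}q^i)\,\omega_q(y,z|\rho_{23}q^i)\right)},$$ with $C_{3D}$ the constant making it a probability density on $S(q)^3$. The $q$-Hermite polynomials are given by $H_{-1}(x|q)=0$, $H_0(x|q)=1$, $H_{n+1}(x|q)=x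H_n(x|q)-[n]_qH_{n-1}(x|q)$.
   Formalization: The prefactor 2(1+r)/π of the last displayed form is corrected to (1+r)√(1−q)/(2π); as printed it is false (for q=0 and all ρ=0 it is 4 times f_N(z|0) for |z|<2). *)

(* Defs.v *)
From HB Require Import structures.
From mathcomp Require Import all_boot all_order all_algebra.
From mathcomp Require Import all_classical all_reals all_analysis.

Set Implicit Arguments.
Unset Strict Implicit.
Unset Printing Implicit Defensive.

Import Order.TTheory GRing.Theory Num.Theory.
Import numFieldNormedType.Exports.

Local Open Scope classical_set_scope.
Local Open Scope ring_scope.

Section QSeries.
Variable R : realType.
Implicit Types (q a x y z r : R) (n j : nat).

Definition qnum q n : R := \sum_(0 <= i < n) q ^+ i.

Definition qfact q n : R := \prod_(1 <= i < n.+1) qnum q i.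

Definition qpoch q a j : R := \prod_(1 <= k < j.+1) (1 - a * q ^+ k.-1).

Definition qpochoo q a : R := \big[*%R/1]_(0 <= k <oo) (1 - a * q ^+ k).

(* The inner [match] at [0] is the convention $H_{-1} = 0$. *)
Fixpoint qHermite q x n : R :=
  match n with
  | 0%N => 1
  | m.+1 => x * qHermite q x m
            - qnum q m * match m with 0%N => 0 | p.+1 => qHermite q x p end
  end.

Definition lq q x a : R := (1 + a) ^+ 2 - (1 - q) * a * x ^+ 2.

Definition omegaq q x y r : R :=
  (1 - r ^+ 2) ^+ 2 - (1 - q) * x * y * r * (1 + r ^+ 2)
  + (1 - q) * r ^+ 2 * (x ^+ 2 + y ^+ 2).

Definition Sq q : set R :=
  `[- (2 / Num.sqrt (1 - q)), 2 / Num.sqrt (1 - q)]%classic.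

Definition fN q x : R :=
  qpochoo q q * Num.sqrt (1 - q) * Num.sqrt (4 - (1 - q) * x ^+ 2) / (2 * pi)
  * \big[*%R/1]_(1 <= i <oo) lq q x (q ^+ i).

Definition fCN q x y r : R :=
  fN q x * (qpochoo q (r ^+ 2) / \big[*%R/1]_(0 <= i <oo) omegaq q x y (r * q ^+ i)).

Section ThreeDim.
Variables (q r12 r13 r23 : R).

Let mu := @lebesgue_measure R.

(* $f_{3D}$ without the normalizing constant $C_{3D}$ *)
Definition g3D x y z : R :=
  fN q x * fN q y * fN q z *
  (qpochoo q (r12 ^+ 2) * qpochoo q (r13 ^+ 2) * qpochoo q (r23 ^+ 2)
   / \big[*%R/1]_(0 <= i <oo) (omegaq q x y (r12 * q ^+ i)
                         * omegaq q x z (r13 * q ^+ i)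
                         * omegaq q y z (r23 * q ^+ i))).

Definition C3D : R :=
  (fine (\int[(mu \x mu) \x mu]_(p in (Sq q `*` Sq q) `*` Sq q)
           (g3D p.1.1 p.1.2 p.2)%:E)%E)^-1.

Definition f3D x y z : R := C3D * g3D x y z.

(* Marginals are valued in the extended reals, so that an equation with a real
   number asserts finiteness of the integral. *)
Definition fX x : \bar R :=
  (\int[mu \x mu]_(p in Sq q `*` Sq q) (f3D x p.1 p.2)%:E)%E.

Definition fY y : \bar R :=
  (\int[mu \x mu]_(p in Sq q `*` Sq q) (f3D p.1 y p.2)%:E)%E.

Definition fZ z : \bar R :=
  (\int[mu \x mu]_(p in Sq q `*` Sq q) (f3D p.1 p.2 z)%:E)%E.

End ThreeDim.

Definition sqHermite_term q r z j : R :=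
  r ^+ j / qfact q j * qHermite q z j ^+ 2.

Definition evenHermite_term q r z k : R :=
  r ^+ k / (qfact q k * qpoch q r k.+1) * qHermite q z k.*2.

Definition form_squares q r z : R :=
  (1 - r) * fN q z * limn (series (sqHermite_term q r z)).

Definition form_conditional q r z : R := (1 - r) * fCN q z z r.

Definition form_product q r z : R :=
  (1 - r) * fN q z *
  (qpochoo q (r ^+ 2)
   / (qpochoo q r ^+ 2 * \big[*%R/1]_(0 <= i <oo) lq q z (r * q ^+ i))).

Definition form_even q r z : R :=
  (1 - r) * fN q z * limn (series (evenHermite_term q r z)).

(* The prefactor sqrt (1 - q) / 2 is the one forced by the constant
   sqrt (1 - q) / (2 * pi) in [fN]. *)
Definition form_explicit q r z : R :=
  (1 + r) * Num.sqrt (1 - q) * Num.sqrt (4 - (1 - q) * z ^+ 2)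
  * qpochoo q q * qpochoo q (r ^+ 2 * q)
  / (2 * pi * lq q z r * qpochoo q (r * q) ^+ 2)
  * \big[*%R/1]_(1 <= j <oo) (lq q z (q ^+ j) / lq q z (r * q ^+ j)).

End QSeries.

(* Main.v *)
Require Import Defs.
From HB Require Import structures.
From mathcomp Require Import all_boot all_order all_algebra.
From mathcomp Require Import all_classical all_reals all_analysis.
From mathcomp Require Import measurable_realfun.
From mathcomp Require Import zify ring lra.

(** Write w for the weight [fN q] on S(q), H_n for the q-Hermite polynomials,
    and P_a(x, y) for the Mehler kernel, the sum over n of
    a^n H_n(x) H_n(y) / [n]_q! ([mehler]).

    Two facts give the marginals. The Poisson-Mehler formula [mehlerE] says
    that P_a(x, y) = (a^2)_oo / prod_i omega_q(x, y | a q^i), so that the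
    density is, up to its constant, w(x) w(y) w(z) times a product of three
    Mehler kernels, one for each pair of variables ([g3D_chain3]). The H_n
    are orthogonal for w with squared norm [n]_q! ([nHermitePoly_orthogonal]),
    so that Mehler kernels compose like diagonal operators: integrating
    w(x) P_a(x, y) P_b(x, z) over x gives P_ab(y, z) ([mehler_composition]).
    Integrating out any two of the three variables therefore leaves
    w(z) P_r(z, z), and integrating this once more gives the trace
    sum_n r^n = 1 / (1 - r) ([mehler_trace]), whence C_3D = 1 - r. The closed
    forms are evaluations of P_r(z, z).

    The Mehler kernel and the expansion in the H_(2k) are summed by the same
    device. As functions F of the parameter a they satisfy F(a q^n) -> 1 and
    omega(a) F(a) = (1 - a^2)(1 - q a^2) F(a q), where omega(a) stands for
    omega_q(x, y | a), with x = y = z in the second case; iterating the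
    equation forces F(a) = (a^2)_oo / prod_i omega(a q^i)
    ([qdifference_solution]). The equation itself is a telescoping identity:
    the partial sums satisfy it up to an explicit remainder built from the
    last terms of the sum ([mehler_partial], [evenHermite_partial]), and the
    remainder tends to 0.

    Orthogonality is reduced to the Chebyshev polynomials V_m of the second
    kind, scaled to S(q). They are orthonormal for the semicircle density, by
    the substitution x = 2 cos t / sqrt (1 - q). Multiplication by l_q(x | a)
    sends V_m to (1 + a^2) V_m - a (V_(m+2) + V_(m-2)), so that the integrals
    of V_m against the semicircle density times a finite product of the
    l_q(x | q^i) obey a Pascal recursion, solved by Gaussian binomials (a
    finite form of the Jacobi triple product). In the limit the integral of
    w V_(2k) is (-1)^k q^(k(k+1)/2) ([wint_fN_cheb_even]). The three-term
    recurrence carries this to the integrals of w H_n V_m, in particular to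
    those of w H_n, and from there to those of w H_n H_m.

    All the series are dominated through one estimate: on S(q),
    H_n(x) (1 - q)^(n/2) grows more slowly than any exponential, uniformly in
    x ([qHermite_growth]). The infinite products are bounded and kept away
    from 0 by [prod_near1_le] and [prod_near1_ge]. *)

Set Implicit Arguments.
Unset Strict Implicit.
Unset Printing Implicit Defensive.

Import Order.TTheory GRing.Theory Num.Theory.
Import numFieldNormedType.Exports.
Local Open Scope classical_set_scope.
Local Open Scope ring_scope.

(** * Infinite products with factors close to 1 *)

Lemma geometric_sum_le (R : realType) (p : R) n : 0 <= p < 1 ->
  \sum_(0 <= k < n) p ^+ k <= (1 - p)^-1.
Proof.
move=> /andP[p0 p1]; have hp : 0 < 1 - p by rewrite subr_gt0.
rewrite -[leRHS]mul1r ler_pdivlMr//.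
suff -> : (\sum_(0 <= k < n) p ^+ k) * (1 - p) = 1 - p ^+ n.
  by rewrite gerBl exprn_ge0.
elim: n => [|n IH]; first by rewrite big_nil expr0; ring.
by rewrite big_nat_recr//= mulrDl IH exprSr; ring.
Qed.

(** The telescoping series of u is dominated by a geometric one. *)
Lemma is_cvg_geometric_steps (R : realType) (u : R ^nat) (C p : R) :
  0 <= p < 1 -> (forall n, `|u n.+1 - u n| <= C * p ^+ n) -> cvgn u.
Proof.
move=> /andP[p0 p1] hu.
have h : cvgn (series (telescope u)).
  apply: normed_cvg; apply: (@series_le_cvg _ _ (geometric C p)).
  - by move=> n; exact: normr_ge0.
  - by move=> n; apply: le_trans (hu n).
  - by move=> n; exact: hu.
  - by apply: is_cvg_geometric_series; rewrite ger0_norm.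
have -> : u = cst (u 0%N) \+ series (telescope u).
  by apply/funext => n; rewrite /= [LHS]eq_sum_telescope.
by apply: is_cvgD => //; exact: is_cvg_cst.
Qed.

(** Each factor is at most exp (C p^k), and the exponents have a bounded sum. *)
Lemma prod_near1_le (R : realType) (f : R ^nat) (C p : R) n : 0 <= p < 1 ->
  (forall k, `|f k - 1| <= C * p ^+ k) ->
  `|\prod_(0 <= k < n) f k| <= expR (C / (1 - p)).
Proof.
move=> hp hf; rewrite normr_prod.
have C0 : 0 <= C by have := le_trans (normr_ge0 _) (hf 0%N); rewrite expr0 mulr1.
apply: (@le_trans _ _ (\prod_(0 <= k < n) expR (C * p ^+ k))).
  apply: ler_prod => k _; rewrite normr_ge0/=.
  apply: le_trans (expR_ge1Dx (C * p ^+ k)).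
  rewrite -[f k](subrK 1) addrC (le_trans (ler_normD _ _))// normr1 lerD2l.
  exact: hf.
rewrite -expR_sum ler_expR -mulr_sumr ler_wpM2l//.
exact: geometric_sum_le.
Qed.

Lemma is_cvg_prod_near1 (R : realType) (f : R ^nat) (C p : R) : 0 <= p < 1 ->
  (forall k, `|f k - 1| <= C * p ^+ k) ->
  cvgn (fun n => \prod_(0 <= k < n) f k).
Proof.
move=> hp hf.
apply: (@is_cvg_geometric_steps _ _ (expR (C / (1 - p)) * C) p hp) => n.
rewrite big_nat_recr//= -[X in _ - X]mulr1 -mulrBr normrM -mulrA.
by apply: ler_pM => //; exact: prod_near1_le.
Qed.

(** The inverses of the factors are again geometrically close to 1, so that the
    upper bound applies to them. This is what keeps infinite products away
    from 0. *)
Lemma prod_near1_ge (R : realType) (f : R ^nat) (C p d : R) n : 0 <= p < 1 ->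
  (forall k, `|f k - 1| <= C * p ^+ k) -> 0 < d -> (forall k, d <= f k) ->
  expR (- (C / d / (1 - p))) <= \prod_(0 <= k < n) f k.
Proof.
move=> hp hf d0 hd; have f0 k : 0 < f k := lt_le_trans d0 (hd k).
have P0 : 0 < \prod_(0 <= k < n) f k by exact: prodr_gt0.
rewrite expRN -[leRHS]invrK lef_pV2 ?posrE ?expR_gt0 ?invr_gt0//.
rewrite -prodfV; apply: le_trans (ler_norm _) _.
apply: prod_near1_le => // k.
have -> : (f k)^-1 - 1 = - (f k - 1) / f k.
  by have := lt0r_neq0 (f0 k) => ?; field.
rewrite normrM normrN normfV (gtr0_norm (f0 k)) [leRHS]mulrAC.
apply: ler_pM => //; first by rewrite invr_ge0 ltW.
by rewrite lef_pV2 ?posrE.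
Qed.

Lemma cvg_prod_near1 (R : realType) (f : R ^nat) (C p d : R) : 0 <= p < 1 ->
  (forall k, `|f k - 1| <= C * p ^+ k) ->
  0 < d -> (forall k, d <= f k) ->
  exists2 l : R, 0 < l & (fun n => \prod_(0 <= k < n) f k) @ \oo --> l.
Proof.
move=> hp hf d0 hd; have cf := @is_cvg_prod_near1 _ f C p hp hf.
exists (limn (fun n => \prod_(0 <= k < n) f k)) => //.
apply: lt_le_trans (expR_gt0 (- (C / d / (1 - p)))) _.
apply: limr_ge => //; near=> n; exact: prod_near1_ge.
Unshelve. all: by end_near.
Qed.

(** * q-factorials and q-shifted factorials *)

Section QBasics.
Variables (R : realType) (q : R).
Hypothesis hq : -1 < q < 1.

Lemma subr1q_gt0 : 0 < 1 - q.
Proof. by case/andP: hq => _; rewrite subr_gt0. Qed.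

Lemma normq_lt1 : 0 <= `|q| < 1.
Proof. by rewrite normr_ge0 ltr_norml. Qed.

Lemma mul_subr1_qnum n : (1 - q) * qnum q n = 1 - q ^+ n.
Proof.
rewrite /qnum; elim: n => [|n IH]; first by rewrite big_nil mulr0 expr0 subrr.
by rewrite big_nat_recr//= mulrDr IH exprS; ring.
Qed.

Lemma ltr_qexp1 n : q ^+ n.+1 < 1.
Proof.
apply: le_lt_trans (ler_norm _) _; rewrite normrX exprn_ilt1//.
by case/andP: normq_lt1.
Qed.

Lemma qnum_gt0 n : 0 < qnum q n.+1.
Proof.
rewrite -(pmulr_rgt0 _ subr1q_gt0) mul_subr1_qnum subr_gt0.
exact: ltr_qexp1.
Qed.

Lemma qfactS n : qfact q n.+1 = qfact q n * qnum q n.+1.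
Proof. by rewrite /qfact big_nat_recr. Qed.

Lemma qfact0 : qfact q 0 = 1. Proof. by rewrite /qfact big_nil. Qed.

Lemma qfact_gt0 n : 0 < qfact q n.
Proof.
elim: n => [|n IH]; first by rewrite qfact0.
by rewrite qfactS mulr_gt0// qnum_gt0.
Qed.

Lemma qpochE a n : qpoch q a n = \prod_(0 <= k < n) (1 - a * q ^+ k).
Proof. by rewrite /qpoch big_add1. Qed.

Lemma qpoch0 a : qpoch q a 0 = 1. Proof. by rewrite /qpoch big_nil. Qed.

Lemma qpochS a n : qpoch q a n.+1 = qpoch q a n * (1 - a * q ^+ n).
Proof. by rewrite !qpochE big_nat_recr. Qed.

Lemma qpoch_qfact n : qpoch q q n = (1 - q) ^+ n * qfact q n.
Proof.
elim: n => [|n IH]; first by rewrite qpoch0 qfact0 expr0 mulr1.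
by rewrite qpochS IH qfactS exprSr -exprS -mul_subr1_qnum; ring.
Qed.

Lemma normr_qpoch_factor a k : `|(1 - a * q ^+ k) - 1| <= `|a| * `|q| ^+ k.
Proof. by rewrite addrAC subrr add0r normrN normrM normrX. Qed.

Lemma qpoch_factor_ge a k : `|a| < 1 -> 1 - `|a| <= 1 - a * q ^+ k.
Proof.
move=> a1; rewrite lerD2l lerN2 (le_trans (ler_norm _))// normrM normrX.
rewrite ler_piMr// exprn_ile1//; by case/andP: normq_lt1 => _ /ltW.
Qed.

Lemma cvg_qpoch a : qpoch q a @ \oo --> qpochoo q a.
Proof.
have -> : qpoch q a = fun n => \prod_(0 <= k < n) (1 - a * q ^+ k).
  by apply/funext => n; rewrite qpochE.
exact: is_cvg_prod_near1 normq_lt1 (normr_qpoch_factor a).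
Qed.

Lemma qpochoo_gt0 a : `|a| < 1 -> 0 < qpochoo q a.
Proof.
move=> a1; have a1' : 0 < 1 - `|a| by rewrite subr_gt0.
have [l l0 hl] := cvg_prod_near1 normq_lt1 (normr_qpoch_factor a) a1'
  (fun k => qpoch_factor_ge k a1).
by rewrite /qpochoo (cvg_lim (@norm_hausdorff _ _) hl).
Qed.

Lemma qpoch_gt0 a n : `|a| < 1 -> 0 < qpoch q a n.
Proof.
move=> a1; rewrite qpochE; apply: prodr_gt0 => k _.
by apply: lt_le_trans (qpoch_factor_ge k a1); rewrite subr_gt0.
Qed.

(** The bound is uniform in a, because denominators such as (r q^n)_k have to
    be controlled for all n at once. *)
Lemma qpoch_ge (a0 : R) : a0 < 1 ->
  exists2 c : R, 0 < c & forall a n, `|a| <= a0 -> c <= qpoch q a n.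
Proof.
move=> a01; have a01' : 0 < 1 - a0 by rewrite subr_gt0.
exists (expR (- (a0 / (1 - a0) / (1 - `|q|)))) => [|a n aa0]; first exact: expR_gt0.
rewrite qpochE; apply: prod_near1_ge => // [|k|k]; first exact: normq_lt1.
  by rewrite (le_trans (normr_qpoch_factor a k))// ler_wpM2r// exprn_ge0.
by apply: le_trans (qpoch_factor_ge k (le_lt_trans aa0 a01)); rewrite lerD2l lerN2.
Qed.

Lemma qHermiteS x n : qHermite q x n.+2 =
  x * qHermite q x n.+1 - qnum q n.+1 * qHermite q x n.
Proof. by []. Qed.

Lemma normr_Sq x : Sq q x -> `|Num.sqrt (1 - q) * x| <= 2.
Proof.
have s0 : 0 < Num.sqrt (1 - q) by rewrite sqrtr_gt0 subr1q_gt0.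
rewrite /Sq/= in_itv/= -ler_norml ler_pdivlMr// => h.
by rewrite normrM (gtr0_norm s0) mulrC.
Qed.

Lemma sqr_Sq x : Sq q x -> (1 - q) * x ^+ 2 <= 4.
Proof.
move=> /normr_Sq h; have -> : 4 = 2 ^+ 2 :> R by ring.
rewrite -{1}[1 - q]sqr_sqrtr ?(ltW subr1q_gt0)// -exprMn -real_normK ?num_real//.
by rewrite lerXn2r// ?nnegrE.
Qed.

End QBasics.

(** * Growth of the q-Hermite polynomials *)

(** The left-hand side is a sum of n + 1 copies of t^n, each at most one of the
    terms 1, t, ..., t^n of the geometric sum. *)
Lemma mulrn_expr_le (R : realType) (t : R) n : 0 <= t < 1 ->
  n.+1%:R * t ^+ n <= (1 - t)^-1.
Proof.
move=> ht; apply: le_trans (geometric_sum_le n.+1 ht); case/andP: ht => t0 t1.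
have -> : n.+1%:R * t ^+ n = \sum_(0 <= k < n.+1) t ^+ n.
  by rewrite sumr_const_nat subn0 mulr_natl.
rewrite !big_mkord; apply: ler_sum => i _.
by apply: ler_wiXn2l => //; [exact: ltW|rewrite -ltnS].
Qed.

(** Without the term q^(n+1) the recurrence is that of the Chebyshev
    polynomials, for which the quadratic form
    E n = h(n+1)^2 - X h(n+1) h(n) + h(n)^2 is constant and dominates
    (|h(n+1)| - |h(n)|)^2 when |X| <= 2; hence h grows at most linearly. The
    perturbation increases the square root of E n by at most
    |q|^(n+1) |h(n)|, which is summable in the presence of linear growth. *)
Lemma perturbed_chebyshev_le (R : realType) (q X : R) (h : R ^nat) :
  -2 <= X <= 2 -> h 0%N = 1 -> h 1%N = X ->
  (forall n, h n.+2 = X * h n.+1 - (1 - q ^+ n.+1) * h n) ->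
  forall n, `|h n| <= n.+1%:R *
    \prod_(0 <= k < n) (1 + k.+1%:R * `|q| ^+ k.+1).
Proof.
move=> hX h0 h1 hS.
pose C n := \prod_(0 <= k < n) (1 + k.+1%:R * `|q| ^+ k.+1).
have CS n : C n.+1 = C n * (1 + n.+1%:R * `|q| ^+ n.+1).
  by rewrite /C big_nat_recr.
have C0 n : 0 <= C n.
  by apply: prodr_ge0 => k _; rewrite addr_ge0// mulr_ge0// exprn_ge0.
pose E n := h n.+1 ^+ 2 - X * h n.+1 * h n + h n ^+ 2.
have EE n : (`|h n.+1| - `|h n|) ^+ 2 <= E n.
  rewrite /E sqrrB !real_normK ?num_real//.
  rewrite !lerD2r lerD2l lerN2 -mulrA (le_trans (ler_norm _))//.
  by rewrite !normrM -mulr_natl ler_wpM2r ?mulr_ge0// ler_norml.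
suff H n : `|h n| <= n.+1%:R * C n /\ E n <= C n ^+ 2 by move=> n; case: (H n).
elim: n => [|n [IH1 IH2]].
  rewrite /E h0 h1 /C big_nil normr1 mulr1; split => //.
  by rewrite expr1n le_eqVlt; apply/orP; left; apply/eqP; ring.
have step : `|h n.+1| <= `|h n| + C n.
  rewrite -lerBlDl (le_trans (ler_norm _))//.
  by rewrite -(ler_sqr (normr_nneg _) (C0 n)) real_normK ?num_real// (le_trans (EE n)).
have q0 : 0 <= n.+1%:R * `|q| ^+ n.+1 by rewrite mulr_ge0// exprn_ge0.
split.
  apply: (le_trans step); rewrite CS -natr1 mulrDl mul1r lerD//.
    by rewrite (le_trans IH1)// ler_wpM2l// ler_peMr// lerDl.
  by rewrite ler_peMr// lerDl.
pose e := q ^+ n.+1 * h n.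
have -> : E n.+1 = E n + e * (X * h n.+1 - 2 * h n) + e ^+ 2.
  by rewrite /E /e hS; ring.
have he : `|e| <= n.+1%:R * `|q| ^+ n.+1 * C n.
  rewrite /e normrM normrX [leRHS]mulrAC mulrC ler_wpM2r//.
(* (X h(n+1) - 2 h(n))^2 = 4 E n - (4 - X^2) h(n+1)^2 *)
have h2 : `|X * h n.+1 - 2 * h n| <= 2 * C n.
  rewrite -(ler_sqr (normr_nneg _)) ?nnegrE ?mulr_ge0// real_normK ?num_real//.
  rewrite exprMn; apply: (@le_trans _ _ (4 * E n)); last first.
    by rewrite (_ : 2 ^+ 2 = 4) ?ler_pM2l//; ring.
  rewrite -subr_ge0.
  have -> : 4 * E n - (X * h n.+1 - 2 * h n) ^+ 2 = (2 - X) * (2 - - X) * h n.+1 ^+ 2.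
    by rewrite /E; ring.
  case/andP: hX => X1 X2.
  by rewrite mulr_ge0 ?sqr_ge0// mulr_ge0// subr_ge0// lerNl.
apply: (@le_trans _ _ ((C n + `|e|) ^+ 2)).
  rewrite sqrrD real_normK ?num_real// lerD2r lerD// (le_trans (ler_norm _))//.
  by rewrite normrM mulrC -[leRHS]mulr_natl mulrA ler_wpM2r.
rewrite ler_sqr ?nnegrE ?addr_ge0//.
by rewrite CS mulrDr mulr1 lerD2l mulrC.
Qed.

(** The growth is at most linear by [perturbed_chebyshev_le]; a bound with t < 1
    is the form in which it dominates series. *)
Lemma qHermite_growth (R : realType) (q t : R) : -1 < q < 1 -> 0 <= t < 1 ->
  exists2 K : R, 0 <= K & forall x n, Sq q x ->
    `|Num.sqrt (1 - q) ^+ n * qHermite q x n| * t ^+ n <= K.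
Proof.
move=> hq ht; have q01 := normq_lt1 hq.
pose p := Num.sqrt `|q|.
have p2 : p ^+ 2 = `|q| by rewrite sqr_sqrtr.
have p01 : 0 <= p < 1.
  rewrite sqrtr_ge0/= -sqrtr1 ltr_sqrt//; by case/andP: q01.
set s := Num.sqrt (1 - q).
have s2 : s ^+ 2 = 1 - q by rewrite sqr_sqrtr// ltW// subr1q_gt0.
pose M := expR ((1 - p)^-1 / (1 - p)).
exists ((1 - t)^-1 * M) => [|x n xS].
  by rewrite mulr_ge0 ?expR_ge0// invr_ge0 subr_ge0; case/andP: ht => _ /ltW.
have := normr_Sq hq xS; rewrite -/s => hX; rewrite ler_norml in hX.
pose h n := s ^+ n * qHermite q x n.
have h0 : h 0%N = 1 by rewrite /h /= mulr1.
have h1 : h 1%N = s * x by rewrite /h /= /qnum big_nil; ring.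
have hS m : h m.+2 = s * x * h m.+1 - (1 - q ^+ m.+1) * h m.
  by rewrite /h qHermiteS -mul_subr1_qnum -s2 !exprS; ring.
have H := perturbed_chebyshev_le hX h0 h1 hS n.
apply: (@le_trans _ _ (n.+1%:R * M * t ^+ n)).
  rewrite ler_wpM2r//; first by rewrite exprn_ge0//; case/andP: ht.
  apply: (le_trans H); rewrite ler_wpM2l//.
  apply: le_trans (ler_norm _) _; apply: prod_near1_le => // k.
  rewrite addrAC subrr add0r normrM normr_nat normrX normr_id -p2.
  rewrite -exprM mul2n -addnn exprD mulrA.
  case/andP: (p01) => p0 p1; apply: ler_pM; rewrite ?mulr_ge0 ?exprn_ge0//.
    apply: le_trans (mulrn_expr_le k p01).
    by rewrite ler_wpM2l// exprS ler_piMl ?exprn_ge0// ltW.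
  by rewrite exprS ler_piMl ?exprn_ge0// ltW.
by rewrite mulrAC ler_wpM2r ?expR_ge0// mulrn_expr_le.
Qed.

(** * Geometrically dominated series *)

Section DominatedSeries.
Variables (R : realType) (f : R ^nat) (K th : R).
Hypotheses (hth : 0 <= th < 1) (hf : forall n, `|f n| <= K * th ^+ n).

Lemma is_cvg_series_dominated : cvgn (series f).
Proof.
apply: normed_cvg; apply: (@series_le_cvg _ _ (geometric K th)).
- by move=> n; exact: normr_ge0.
- by move=> n; apply: le_trans (hf n).
- by move=> n; exact: hf.
- by case/andP: hth => *; apply: is_cvg_geometric_series; rewrite ger0_norm.
Qed.

Lemma normr_series_dominated n : `|series f n| <= K / (1 - th).
Proof.
have K0 : 0 <= K by have := le_trans (normr_ge0 _) (hf 0%N); rewrite expr0 mulr1.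
rewrite /series/= (le_trans (ler_norm_sum _ _ _))//.
apply: (@le_trans _ _ (\sum_(0 <= k < n) K * th ^+ k)).
  by apply: ler_sum => i _; exact: hf.
by rewrite -mulr_sumr ler_wpM2l//; exact: geometric_sum_le.
Qed.

Lemma normr_lim_series_dominated : `|limn (series f)| <= K / (1 - th).
Proof.
rewrite -lim_norm; last exact: is_cvg_series_dominated.
apply: limr_le; first by apply: is_cvg_norm; exact: is_cvg_series_dominated.
by near=> n; exact: normr_series_dominated.
Unshelve. all: by end_near.
Qed.

End DominatedSeries.

(** Used at the points a q^n, where every term but the first carries a factor
    q^n: the sum then tends to its first term. *)
Lemma normr_lim_seriesB0 (R : realType) (f : R ^nat) (K th : R) :
  0 <= th < 1 -> (forall n, `|f n.+1| <= K * th ^+ n) ->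
  `|limn (series f) - f 0%N| <= K / (1 - th).
Proof.
move=> hth hf.
have h1 := @normr_lim_series_dominated _ (fun n => f n.+1) K th hth hf.
have h2 := @is_cvg_series_dominated _ (fun n => f n.+1) K th hth hf.
suff -> : limn (series f) = f 0%N + limn (series (fun n => f n.+1)).
  by rewrite addrAC subrr add0r.
apply: cvg_lim => //; rewrite -cvg_shiftS.
have -> : (fun n => series f n.+1) = cst (f 0%N) \+ series (fun n => f n.+1).
  by apply/funext => n; rewrite /series/= big_nat_recl.
by apply: cvgD => //; exact: cvg_cst.
Qed.

(** * Normalized Hermite polynomials and the q-difference equation *)

Section NormalizedHermite.
Variables (R : realType) (q : R).
Hypothesis hq : -1 < q < 1.
Implicit Types (x y z r a : R) (n k : nat).

(** The scaling removes the factors 1 - q: the recurrence becomes that of the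
    continuous q-Hermite polynomials in the variable sqrt (1 - q) x. *)
Definition nHermite x n : R := Num.sqrt (1 - q) ^+ n * qHermite q x n.

Lemma sqr_sqrt1q : Num.sqrt (1 - q) ^+ 2 = 1 - q.
Proof. by rewrite sqr_sqrtr// ltW// subr1q_gt0. Qed.

Lemma sqrt1q_gt0 : 0 < Num.sqrt (1 - q).
Proof. by rewrite sqrtr_gt0 subr1q_gt0. Qed.

Lemma nHermite0 x : nHermite x 0 = 1.
Proof. by rewrite /nHermite expr0 mul1r. Qed.

Lemma nHermite1 x : nHermite x 1 = Num.sqrt (1 - q) * x.
Proof. by rewrite /nHermite expr1/= /qnum big_nil; ring. Qed.

Lemma nHermiteS x n : nHermite x n.+2 =
  Num.sqrt (1 - q) * x * nHermite x n.+1 - (1 - q ^+ n.+1) * nHermite x n.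
Proof.
rewrite /nHermite qHermiteS -mul_subr1_qnum -[X in X * qnum _ _ * _]sqr_sqrt1q.
by rewrite !exprS; ring.
Qed.

(** A number t < 1 with a < t^2 is fixed, and the growth estimate is used with
    this t: a^n leaves room for two polynomials of degree at most n, or for
    one of degree at most 2 n. *)
Lemma nHermite_decay a : 0 <= a < 1 -> exists K th : R,
  [/\ 0 <= K, 0 <= th < 1,
    forall x y n i j, Sq q x -> Sq q y -> (i <= n)%N -> (j <= n)%N ->
      a ^+ n * `|nHermite x i * nHermite y j| <= K * th ^+ n &
    forall x n i, Sq q x -> (i <= n.*2)%N ->
      a ^+ n * `|nHermite x i| <= K * th ^+ n].
Proof.
move=> /andP[a0 a1].
(* t^2 is the midpoint of a and 1 *)
pose b := (1 + a) / 2; have b1 : b < 1 by rewrite /b; lra.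
have ab : a < b by rewrite /b; lra.
have b0 : 0 < b by exact: le_lt_trans ab.
pose t := Num.sqrt b.
have t2 : t ^+ 2 = b by rewrite sqr_sqrtr// ltW.
have t0 : 0 < t by rewrite sqrtr_gt0.
have t1 : t < 1 by rewrite -sqrtr1 ltr_sqrt.
have t01 : 0 <= t < 1 by rewrite (ltW t0).
have [K K0 hK] := qHermite_growth hq t01.
have {}hK x n i : Sq q x -> (i <= n)%N -> `|nHermite x i| * t ^+ n <= K.
  move=> xS le_in; apply: le_trans (hK x i xS); rewrite ler_wpM2l//.
  by rewrite ler_wiXn2l// ltW.
have th0 : 0 <= a / b by rewrite divr_ge0// ltW.
have aE n : a ^+ n = (a / b) ^+ n * (t ^+ n * t ^+ n).
  rewrite -exprMn -expr2 t2 -exprMn -mulrA mulVf ?mulr1//; exact: lt0r_neq0.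
exists (K + K ^+ 2), (a / b); split.
- by rewrite addr_ge0// sqr_ge0.
- by rewrite th0/= ltr_pdivrMr// mul1r.
- move=> x y n i j xS yS le_in le_jn; rewrite aE -mulrA [leRHS]mulrC.
  rewrite ler_wpM2l ?exprn_ge0// normrM mulrACA.
  apply: (@le_trans _ _ (K * K)); last by rewrite -expr2 lerDr.
  by apply: ler_pM; rewrite ?mulr_ge0 ?exprn_ge0// ?(ltW t0)// mulrC hK.
- move=> x n i xS le_in; rewrite aE -mulrA [leRHS]mulrC.
  rewrite ler_wpM2l ?exprn_ge0// -exprD addnn mulrC.
  by rewrite (le_trans (hK x _ _ xS le_in))// lerDl sqr_ge0.
Qed.

Section Omega.
Variables x y : R.
Hypotheses (xS : Sq q x) (yS : Sq q y).
Let X := Num.sqrt (1 - q) * x.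
Let Y := Num.sqrt (1 - q) * y.

Lemma omegaqE r : omegaq q x y r =
  (1 - r ^+ 2) ^+ 2 - X * Y * r * (1 + r ^+ 2) + r ^+ 2 * (X ^+ 2 + Y ^+ 2).
Proof. by rewrite /omegaq -sqr_sqrt1q /X /Y; ring. Qed.

(** With u = |X|, v = |Y| and s = |r|, the form is at least
    (1 - s)^4 + (4 - u v) s (1 - s)^2 + s^2 (u - v)^2, and u, v <= 2 on S(q). *)
Lemma omegaq_ge r : `|r| <= 1 -> (1 - `|r|) ^+ 4 <= omegaq q x y r.
Proof.
move=> r1; rewrite omegaqE -[r ^+ 2]real_normK ?num_real//.
have hX := normr_Sq hq xS; have hY := normr_Sq hq yS; rewrite -/X -/Y in hX hY.
have h : X * Y * r <= `|X| * `|Y| * `|r|.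
  by rewrite -!normrM ler_norm.
rewrite -[X ^+ 2]real_normK ?num_real// -[Y ^+ 2]real_normK ?num_real//.
move: (normr_ge0 X) (normr_ge0 Y) (normr_ge0 r) hX hY r1 h.
move: `|X| `|Y| `|r| (X * Y * r) => u v s w u0 v0 s0 u2 v2 s1 hw.
have h1 : w * (1 + s ^+ 2) <= u * v * s * (1 + s ^+ 2).
  by rewrite ler_wpM2r// addr_ge0// sqr_ge0.
have h2 : u * v <= 4.
  by rewrite (_ : 4 = 2 * 2) ?ler_pM//; ring.
have h3 : 0 <= (4 - u * v) * (s * (1 - s) ^+ 2).
  by rewrite mulr_ge0 ?subr_ge0// mulr_ge0// sqr_ge0.
have h4 : 0 <= s ^+ 2 * (u - v) ^+ 2 by rewrite mulr_ge0 ?sqr_ge0.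
rewrite -subr_ge0.
have -> : (1 - s ^+ 2) ^+ 2 - w * (1 + s ^+ 2) + s ^+ 2 * (u ^+ 2 + v ^+ 2)
    - (1 - s) ^+ 4 = (4 - u * v) * (s * (1 - s) ^+ 2) + s ^+ 2 * (u - v) ^+ 2 +
    (u * v * s * (1 + s ^+ 2) - w * (1 + s ^+ 2)) by ring.
by rewrite addr_ge0 ?subr_ge0// addr_ge0.
Qed.

Lemma normr_omegaqB1 r : `|r| <= 1 -> `|omegaq q x y r - 1| <= 19 * `|r|.
Proof.
move=> r1; rewrite omegaqE.
have hX := normr_Sq hq xS; have hY := normr_Sq hq yS; rewrite -/X -/Y in hX hY.
have -> : (1 - r ^+ 2) ^+ 2 - X * Y * r * (1 + r ^+ 2) + r ^+ 2 * (X ^+ 2 + Y ^+ 2) - 1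
  = r * (r * (r ^+ 2 - 2 + X ^+ 2 + Y ^+ 2) - X * Y * (1 + r ^+ 2)) by ring.
rewrite normrM mulrC ler_wpM2r// (le_trans (ler_normB _ _))//.
have r2 : `|r| ^+ 2 <= 1 by rewrite exprn_ile1.
have X2 : `|X| ^+ 2 <= 4 by rewrite (_ : 4 = 2 ^+ 2) ?lerXn2r ?nnegrE//; ring.
have Y2 : `|Y| ^+ 2 <= 4 by rewrite (_ : 4 = 2 ^+ 2) ?lerXn2r ?nnegrE//; ring.
have -> : 19 = 11 + 8 :> R by ring.
apply: lerD.
  rewrite normrM -[leRHS]mul1r ler_pM//.
  rewrite (le_trans (ler_normD _ _))// (_ : 11 = 7 + 4); last by ring.
  rewrite normrX lerD//.
  rewrite (le_trans (ler_normD _ _))// (_ : 7 = 3 + 4); last by ring.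
  rewrite normrX lerD// (le_trans (ler_normB _ _))// (_ : 3 = 1 + 2); last by ring.
  by rewrite normrX normr_nat lerD.
have -> : 8 = 2 * 2 * 2 :> R by ring.
rewrite normrM (normrM X Y); apply: ler_pM; rewrite ?mulr_ge0 ?ler_pM//.
by rewrite (le_trans (ler_normD _ _))// normr1 normrX lerD2l.
Qed.

Lemma normr_scaled r k : `|r| <= 1 -> `|r * q ^+ k| <= `|q| ^+ k.
Proof. by move=> r1; rewrite normrM normrX ler_piMl ?exprn_ge0. Qed.

Lemma normr_scaled_le r k : `|r * q ^+ k| <= `|r|.
Proof.
rewrite normrM normrX ler_piMr// exprn_ile1//; by case/andP: (normq_lt1 hq) => _ /ltW.
Qed.

Lemma cvg_omegaq_prod r : `|r| < 1 -> exists2 l : R, 0 < l &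
  (fun n => \prod_(0 <= i < n) omegaq q x y (r * q ^+ i)) @ \oo --> l.
Proof.
move=> r1.
apply: (@cvg_prod_near1 _ _ 19 `|q| ((1 - `|r|) ^+ 4)); first exact: normq_lt1.
- move=> k; apply: (le_trans (normr_omegaqB1 _)).
    by rewrite (le_trans (normr_scaled_le _ _))// ltW.
  by rewrite ler_wpM2l// normr_scaled// ltW.
- by rewrite exprn_gt0// subr_gt0.
- move=> k; have h := normr_scaled_le r k.
  apply: le_trans (omegaq_ge (le_trans h (ltW r1))).
  by rewrite lerXn2r ?nnegrE ?lerD2l ?lerN2// subr_ge0 ?(ltW r1)// (le_trans h (ltW r1)).
Qed.

End Omega.

(** Iterating the equation n times expresses F r through F (r q^n) and a finite
    product; the shifted factorials (r^2)_(2n) come from pairing the factors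
    1 - a^2 and 1 - q a^2. *)
Lemma qdifference_solution x y r (F : R -> R) : Sq q x -> Sq q y -> `|r| < 1 ->
  (forall a, `|a| < 1 -> omegaq q x y a * F a =
     (1 - a ^+ 2) * (1 - q * a ^+ 2) * F (a * q)) ->
  (fun n => F (r * q ^+ n)) @ \oo --> (1 : R) ->
  F r = qpochoo q (r ^+ 2) / \big[*%R/1]_(0 <= i <oo) omegaq q x y (r * q ^+ i).
Proof.
move=> xS yS r1 Feq F1.
have iter n : (\prod_(0 <= i < n) omegaq q x y (r * q ^+ i)) * F r =
    qpoch q (r ^+ 2) n.*2 * F (r * q ^+ n).
  elim: n => [|n IH].
    by rewrite big_nil qpoch0 expr0 mulr1 !mul1r.
  rewrite big_nat_recr//= mulrAC IH -mulrA [X in _ * X]mulrC Feq; last first.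
    exact: le_lt_trans (normr_scaled_le _ _) r1.
  have -> : r * q ^+ n.+1 = r * q ^+ n * q by rewrite exprSr mulrA.
  by rewrite doubleS !qpochS [q ^+ _.*2.+1]exprS -muln2 exprM; ring.
have [l l0 hl] := cvg_omegaq_prod xS yS r1.
rewrite (cvg_lim (@norm_hausdorff _ _) hl).
apply/eqP; rewrite eq_sym -(inj_eq (mulfI (lt0r_neq0 l0))) mulrCA divff ?lt0r_neq0// mulr1.
apply/eqP; apply/esym.
have h1 : (fun n => (\prod_(0 <= i < n) omegaq q x y (r * q ^+ i)) * F r) @ \oo
    --> l * F r by apply: cvgM => //; exact: cvg_cst.
have hd : (fun n => n.*2) @ \oo --> \oo.
  apply/cvgnyPge => A; near=> n; rewrite -addnn (@leq_trans n) ?leq_addr//.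
  by near: n; exact: nbhs_infty_ge.
have h3 : (fun n => qpoch q (r ^+ 2) n.*2) @ \oo --> qpochoo q (r ^+ 2).
  exact: (cvg_comp _ _ hd (@cvg_qpoch _ _ hq (r ^+ 2))).
have h2 : (fun n => qpoch q (r ^+ 2) n.*2 * F (r * q ^+ n)) @ \oo --> qpochoo q (r ^+ 2).
  by rewrite -[qpochoo _ _]mulr1; exact: cvgM h3 F1.
suff e : (fun n => (\prod_(0 <= i < n) omegaq q x y (r * q ^+ i)) * F r) =
    (fun n => qpoch q (r ^+ 2) n.*2 * F (r * q ^+ n)).
  by rewrite -e in h2; exact: cvg_unique (@norm_hausdorff _ _) _ _ _ _ h1 h2.
by apply/funext => n; rewrite iter.
Unshelve. all: by end_near.
Qed.

End NormalizedHermite.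

(** * The Poisson-Mehler formula *)

Section Mehler.
Variables (R : realType) (q : R).
Hypothesis hq : -1 < q < 1.
Implicit Types (x y z r a : R) (n k : nat).

Let q_lt1 : `|q| < 1. Proof. by case/andP: (normq_lt1 hq). Qed.

Definition mehler_term x y r n : R :=
  r ^+ n / qfact q n * (qHermite q x n * qHermite q y n).

Definition mehler x y r : R := limn (series (mehler_term x y r)).

Lemma sqHermite_termE r z : sqHermite_term q r z = mehler_term z z r.
Proof. by apply/funext => n; rewrite /sqHermite_term expr2. Qed.

Lemma mehler_termC x y r : mehler_term x y r = mehler_term y x r.
Proof. by apply/funext => n; rewrite /mehler_term [qHermite q x n * _]mulrC. Qed.

Lemma qpochqq_gt0 n : 0 < qpoch q q n.
Proof. exact: qpoch_gt0. Qed.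

Lemma mehler_termE x y r n : mehler_term x y r n =
  r ^+ n / qpoch q q n * (nHermite q x n * nHermite q y n).
Proof.
rewrite /mehler_term /nHermite [X in _ = _ * X]mulrACA -exprD addnn -mul2n exprM sqr_sqrt1q//.
rewrite qpoch_qfact.
have h1 : (1 - q) ^+ n != 0 := expf_neq0 n (lt0r_neq0 (subr1q_gt0 hq)).
have h2 := lt0r_neq0 (qfact_gt0 hq n).
by field; rewrite h1 h2.
Qed.

Lemma mehler_term_le a : 0 <= a < 1 -> exists K th : R,
  [/\ 0 <= K, 0 <= th < 1 & forall x y r n, Sq q x -> Sq q y -> `|r| <= a ->
    `|mehler_term x y r n| <= K * th ^+ n].
Proof.
move=> /(nHermite_decay hq)[K [th [K0 hth hK _]]].
have [c c0 hc] := qpoch_ge hq q_lt1.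
exists (K / c), th; split => //; first by rewrite divr_ge0// ltW.
move=> x y r n xS yS ra; rewrite mehler_termE mulrAC normrM normfV.
rewrite (gtr0_norm (qpochqq_gt0 n)) [leRHS]mulrAC.
apply: ler_pM; rewrite ?invr_ge0 ?(ltW (qpochqq_gt0 n))//; last first.
  by rewrite lef_pV2 ?posrE// ?qpochqq_gt0// hc.
rewrite normrM normrX.
apply: le_trans (hK _ _ _ _ _ xS yS (leqnn n) (leqnn n)).
by rewrite ler_wpM2r// lerXn2r// nnegrE// (le_trans _ ra).
Qed.

Lemma is_cvg_mehler x y r : Sq q x -> Sq q y -> `|r| < 1 ->
  cvgn (series (mehler_term x y r)).
Proof.
move=> xS yS r1; have a01 : 0 <= `|r| < 1 by rewrite normr_ge0.
have [K [th [K0 hth hK]]] := mehler_term_le a01.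
by apply: (is_cvg_series_dominated hth) => n; exact: hK.
Qed.

Let mehler_rem x y r n : R :=
  let h := nHermite q x in let k := nHermite q y in
  let X := Num.sqrt (1 - q) * x in let Y := Num.sqrt (1 - q) * y in
  r ^+ n.+1 / qpoch q q n *
  (- (1 - r ^+ 2) * (h n.+1 * k n.+1) + r * (X - r * Y) * (h n.+1 * k n)
   + r * (Y - r * X) * (h n * k n.+1)
   - r * (1 - r ^+ 2) * (1 - q ^+ n.+1) * (h n * k n)).

(** In the partial sums of the two sides of the q-difference equation the
    coefficient of each power of r cancels, by the product of the recurrences
    in x and in y, except for the powers at the end. The remainder is a
    bilinear form in the last two polynomials in x and in y, like in the
    Christoffel-Darboux formula. *)
Lemma mehler_partial x y r n :
  omegaq q x y r * series (mehler_term x y r) n.+1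
  - (1 - r ^+ 2) * (1 - q * r ^+ 2) * series (mehler_term x y (r * q)) n.+1
  = mehler_rem x y r n.
Proof.
rewrite (omegaqE hq) /series/=.
elim: n => [|n IH].
  rewrite !big_nat1 !mehler_termE /mehler_rem !nHermite0 !nHermite1 qpoch0.
  by rewrite !expr0 !expr1 invr1; ring.
rewrite big_nat_recr//= [X in _ - _ * X]big_nat_recr//=.
rewrite [X in X - _]mulrDr [X in _ - X]mulrDr opprD addrACA IH !mehler_termE.
rewrite /mehler_rem !(nHermiteS hq) qpochS.
have h1 := lt0r_neq0 (qpochqq_gt0 n).
have h2 : 1 - q * q ^+ n != 0 by rewrite -exprS subr_eq0 eq_sym lt_eqF// ltr_qexp1.
by rewrite [(r * q) ^+ _]exprMn ![q ^+ _.+1]exprS ![r ^+ _.+1]exprS; field; rewrite h1 h2.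
Qed.

Lemma cvg_mehler_rem x y r : Sq q x -> Sq q y -> `|r| < 1 ->
  mehler_rem x y r @ \oo --> (0 : R).
Proof.
move=> xS yS r1; have a01 : 0 <= `|r| < 1 by rewrite normr_ge0.
have [K [th [K0 hth hK _]]] := nHermite_decay hq a01.
have [c c0 hc] := qpoch_ge hq q_lt1.
set X := Num.sqrt (1 - q) * x; set Y := Num.sqrt (1 - q) * y.
pose D := `|- (1 - r ^+ 2)| + `|r * (X - r * Y)| + `|r * (Y - r * X)|
  + `|r * (1 - r ^+ 2)| * 2.
have D0 : 0 <= D by rewrite !addr_ge0// mulr_ge0.
have th1 : `|th| < 1 by case/andP: hth => *; rewrite ger0_norm.
have g0 : (fun n => c^-1 * D * K * th * th ^+ n) @ \oo --> (0 : R).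
  by have := cvg_geometric (c^-1 * D * K * th) th1; apply.
apply/cvgr0Pnorm_le => e e0; move/cvgr0Pnorm_le: g0 => /(_ e e0).
apply: filterS => n; apply: le_trans.
apply: le_trans (ler_norm _).
have H i j : (i <= n.+1)%N -> (j <= n.+1)%N ->
  `|r| ^+ n.+1 * `|nHermite q x i * nHermite q y j| <= K * th ^+ n.+1.
  exact: hK.
rewrite /mehler_rem -/X -/Y mulrAC normrM normrM normfV normrX.
rewrite (gtr0_norm (qpochqq_gt0 n)) mulrC.
have -> : c^-1 * D * K * th * th ^+ n = c^-1 * (D * (K * th ^+ n.+1)).
  by rewrite exprS; ring.
apply: ler_pM; rewrite ?invr_ge0 ?(ltW (qpochqq_gt0 n)) ?mulr_ge0 ?exprn_ge0//.
  by rewrite lef_pV2 ?posrE// ?qpochqq_gt0// hc.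
set KK := K * th ^+ n.+1 in H *.
have hl c' i j : (i <= n.+1)%N -> (j <= n.+1)%N ->
    `|r| ^+ n.+1 * `|c' * (nHermite q x i * nHermite q y j)| <= `|c'| * KK.
  by move=> *; rewrite normrM mulrCA ler_wpM2l// H.
apply: (@le_trans _ _ (`|r| ^+ n.+1 *
   (`|- (1 - r ^+ 2) * (nHermite q x n.+1 * nHermite q y n.+1)|
    + `|r * (X - r * Y) * (nHermite q x n.+1 * nHermite q y n)|
    + `|r * (Y - r * X) * (nHermite q x n * nHermite q y n.+1)|
    + `|r * (1 - r ^+ 2) * (1 - q ^+ n.+1) * (nHermite q x n * nHermite q y n)|))).
  rewrite ler_wpM2l ?exprn_ge0//.
  apply: le_trans (ler_normB _ _) _; rewrite lerD2r.
  apply: le_trans (ler_normD _ _) _; rewrite lerD2r.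
  exact: ler_normD.
rewrite [leLHS]mulrDr [X in X + _ <= _]mulrDr [X in X + _ + _ <= _]mulrDr /D 3!mulrDl.
apply: lerD; first (apply: lerD; first apply: lerD).
- exact: hl.
- exact: hl.
- exact: hl.
apply: le_trans (hl _ _ _ _ _) _ => //.
rewrite ler_wpM2r//; first by rewrite mulr_ge0// exprn_ge0//; case/andP: hth.
rewrite [leLHS]normrM ler_wpM2l// (le_trans (ler_normB _ _))// normr1.
rewrite -[leRHS]/(1 + 1) lerD2l normrX exprn_ile1//.
exact: ltW.
Qed.

Lemma cvg_scaled r : (fun n => r * q ^+ n) @ \oo --> (0 : R).
Proof. exact: cvg_geometric. Qed.

Lemma mehler_qdifference x y r : Sq q x -> Sq q y -> `|r| < 1 ->
  omegaq q x y r * mehler x y r =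
  (1 - r ^+ 2) * (1 - q * r ^+ 2) * mehler x y (r * q).
Proof.
move=> xS yS r1; apply/eqP; rewrite -subr_eq0; apply/eqP.
have rq1 : `|r * q| < 1.
  by rewrite normrM (le_lt_trans _ r1)// ler_piMr// ltW.
have h := cvg_mehler_rem xS yS r1.
pose u n := series (mehler_term x y r) n.+1.
pose v n := series (mehler_term x y (r * q)) n.+1.
have hu : u @ \oo --> mehler x y r by rewrite cvg_shiftS; exact: is_cvg_mehler.
have hv : v @ \oo --> mehler x y (r * q) by rewrite cvg_shiftS; exact: is_cvg_mehler.
have e : mehler_rem x y r = (fun n => omegaq q x y r * u n) \-
    (fun n => (1 - r ^+ 2) * (1 - q * r ^+ 2) * v n).
  by apply/funext => n; rewrite -mehler_partial.
have huv : mehler_rem x y r @ \oo --> omegaq q x y r * mehler x y r -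
    (1 - r ^+ 2) * (1 - q * r ^+ 2) * mehler x y (r * q).
  by rewrite e; apply: cvgB; exact: cvgMr.
exact: cvg_unique (@norm_hausdorff _ _) _ _ _ _ huv h.
Qed.

Lemma cvg_mehler0 x y r : Sq q x -> Sq q y -> `|r| < 1 ->
  (fun n => mehler x y (r * q ^+ n)) @ \oo --> (1 : R).
Proof.
move=> xS yS r1; have a01 : 0 <= `|r| < 1 by rewrite normr_ge0.
have [K [th [K0 hth hK]]] := mehler_term_le a01.
have H n : `|mehler x y (r * q ^+ n) - 1| <= K * th / (1 - th) * `|q| ^+ n.
  have e1 : mehler_term x y (r * q ^+ n) 0 = 1.
    by rewrite /mehler_term qfact0 expr0 invr1 !mulr1.
  rewrite -{1}e1 mulrAC; apply: normr_lim_seriesB0 => // k.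
  have -> : mehler_term x y (r * q ^+ n) k.+1 = (q ^+ n) ^+ k.+1 * mehler_term x y r k.+1.
    by rewrite /mehler_term exprMn; ring.
  have -> : K * th * `|q| ^+ n * th ^+ k = `|q| ^+ n * (K * th ^+ k.+1).
    by rewrite exprS; ring.
  rewrite normrM !normrX; apply: ler_pM; rewrite ?exprn_ge0//.
    by rewrite exprS ler_piMr// ?exprn_ge0// exprn_ile1 ?exprn_ge0// exprn_ile1// ltW.
  exact: (hK x y r k.+1 xS yS (lexx _)).
apply/cvgrPdist_le => e e0.
have g0 : (fun n => K * th / (1 - th) * `|q| ^+ n) @ \oo --> (0 : R).
  by apply: cvg_geometric; rewrite normr_id.
move/cvgr0Pnorm_le: g0 => /(_ e e0); apply: filterS => n; apply: le_trans.
by rewrite distrC (le_trans (H n))// ler_norm.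
Qed.

(** The sum solves the q-difference equation by [mehler_partial], and it tends to
    its first term 1 at the points r q^n. *)
Lemma mehlerE x y r : Sq q x -> Sq q y -> `|r| < 1 ->
  mehler x y r = qpochoo q (r ^+ 2) / \big[*%R/1]_(0 <= i <oo) omegaq q x y (r * q ^+ i).
Proof.
move=> xS yS r1; apply: (qdifference_solution hq) => //.
  by move=> a a1; exact: mehler_qdifference.
exact: cvg_mehler0.
Qed.

End Mehler.

(** * The expansion in Hermite polynomials of even degree *)

Lemma cvg0_bounded_mul (R : realType) (u b : R ^nat) (M : R) :
  (forall n, `|b n| <= M) -> u @ \oo --> (0 : R) ->
  (fun n => b n * u n) @ \oo --> (0 : R).
Proof.
move=> hb u0.
have h : (fun n => M * `|u n|) @ \oo --> (0 : R).
  rewrite -[X in _ --> X](mulr0 M); apply: cvgMr.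
  by rewrite -[X in _ --> X](@normr0 _ R); exact: cvg_norm.
apply/cvgr0Pnorm_le => e e0; move/cvgr0Pnorm_le: h => /(_ e e0).
apply: filterS => n; apply: le_trans; apply: le_trans (ler_norm _).
by rewrite normrM ler_wpM2r.
Qed.

Section EvenExpansion.
Variables (R : realType) (q z : R).
Hypotheses (hq : -1 < q < 1) (zS : Sq q z).
Implicit Types (r a : R) (n k : nat).

Let q_lt1 : `|q| < 1. Proof. by case/andP: (normq_lt1 hq). Qed.

Let t r := evenHermite_term q r z.

Definition evenHermite_sum r : R := limn (series (t r)).

Lemma evenHermite_termE r k : evenHermite_term q r z k =
  r ^+ k / (qpoch q q k * qpoch q r k.+1) * nHermite q z k.*2.
Proof.
rewrite /evenHermite_term /nHermite -mul2n exprM sqr_sqrt1q// qpoch_qfact.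
set P := qpoch _ _ _; set F := qfact _ _; set H := qHermite _ _ _.
rewrite -[_ * F * P]mulrA [(_ * (F * P))^-1]invfM; set FP := (F * P)^-1.
have h1 : (1 - q) ^+ k != 0 := expf_neq0 k (lt0r_neq0 (subr1q_gt0 hq)).
by field.
Qed.

(** The factor |e|^n is kept, since the terms at r q^k have to be compared with
    powers of q^k although their denominators depend on k. *)
Lemma evenHermite_term_le a : 0 <= a < 1 -> exists K th : R,
  [/\ 0 <= K, 0 <= th < 1 & forall r e n, `|r| <= a -> `|e| <= 1 ->
    `|t (r * e) n| <= K * (`|e| * th) ^+ n].
Proof.
move=> a01; have [K [th [K0 hth _ hK]]] := nHermite_decay hq a01.
case/andP: a01 => a0 a1.
have [c c0 hc] := qpoch_ge hq q_lt1; have [d d0 hd] := qpoch_ge hq a1.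
exists (K / (c * d)), th; split => //; first by rewrite divr_ge0// mulr_ge0// ltW.
move=> r e n ra e1; rewrite /t evenHermite_termE.
have rea : `|r * e| <= a by rewrite normrM -[a]mulr1 ler_pM.
have h1 : c <= qpoch q q n by exact: hc.
have h2 : d <= qpoch q (r * e) n.+1 by exact: hd.
have h3 : 0 < qpoch q q n * qpoch q (r * e) n.+1.
  exact: mulr_gt0 (lt_le_trans c0 h1) (lt_le_trans d0 h2).
rewrite mulrAC normrM normfV (gtr0_norm h3) [leRHS]mulrAC.
apply: ler_pM; rewrite ?invr_ge0 ?(ltW h3)//; last first.
  by rewrite lef_pV2 ?posrE// ?mulr_gt0// ler_pM// ltW.
rewrite normrM normrX normrM exprMn exprMn [leRHS]mulrCA [X in X * _]mulrC -mulrA.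
rewrite ler_wpM2l ?exprn_ge0//.
apply: le_trans (hK z n n.*2 zS (leqnn _)); rewrite ler_wpM2r//.
by rewrite lerXn2r// nnegrE.
Qed.

Lemma is_cvg_evenHermite r : `|r| < 1 -> cvgn (series (t r)).
Proof.
move=> r1; have a01 : 0 <= `|r| < 1 by rewrite normr_ge0.
have [K [th [K0 hth hK]]] := evenHermite_term_le a01.
apply: (is_cvg_series_dominated (K := K) hth) => n.
by have := hK r 1 n (lexx _); rewrite mulr1 normr1 mul1r; apply.
Qed.

(** Two steps of the recurrence, which connect polynomials of the same parity. *)
Lemma nHermite_skip n : nHermite q z n.+4 =
  ((1 - q) * z ^+ 2 - (1 - q ^+ n.+2) - (1 - q ^+ n.+3)) * nHermite q z n.+2
  - (1 - q ^+ n.+2) * (1 - q ^+ n.+1) * nHermite q z n.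
Proof. by rewrite !(nHermiteS hq) -[X in X * z ^+ 2](sqr_sqrt1q hq); ring. Qed.

Lemma omegaq_diag r : omegaq q z z r = (1 - r) ^+ 2 * lq q z r.
Proof. by rewrite /omegaq /lq; ring. Qed.

Let rem r n : R :=
  - (1 - q ^+ n.+1) * (1 - r * q ^+ n.+1) * t r n.+1
  + r ^+ 2 * (1 + q ^+ n.+1) * (1 - q ^+ n.*2.+1) / (1 - r * q ^+ n.+1) * t r n.

Lemma qpoch_shift r n : `|r| < 1 ->
  qpoch q (r * q) n = qpoch q r n.+1 / (1 - r).
Proof.
move=> r1; have h : 1 - r != 0.
  by rewrite subr_eq0 eq_sym lt_eqF// (le_lt_trans (ler_norm r)).
elim: n => [|n IH]; first by rewrite qpochS !qpoch0 expr0 mulr1 mul1r divff.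
by rewrite qpochS IH [in RHS]qpochS exprS; field.
Qed.

Lemma subr1_scaled_neq0 r n : `|r| < 1 -> 1 - r * q ^+ n != 0.
Proof.
move=> r1; rewrite lt0r_neq0//.
by apply: lt_le_trans (qpoch_factor_ge hq n r1); rewrite subr_gt0.
Qed.

(** The same mechanism as in [mehler_partial], with the recurrence in steps of
    two and with the denominators (r q)_k = (r)_(k+1) / (1 - r). *)
Lemma evenHermite_partial r n : `|r| < 1 ->
  omegaq q z z r * series (t r) n.+1
  - (1 - r ^+ 2) * (1 - q * r ^+ 2) * series (t (r * q)) n.+1
  = (1 - r) ^+ 2 * rem r n.
Proof.
move=> r1; rewrite omegaq_diag /series/=.
have n1 : 1 - r != 0 by rewrite -[r]mulr1 -(expr0 q) subr1_scaled_neq0.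
have n2 k : 1 - r * q ^+ k != 0 by exact: subr1_scaled_neq0.
elim: n => [|n IH].
  rewrite !big_nat1 /rem /t !evenHermite_termE !qpoch_shift//.
  rewrite !double0 doubleS !(nHermiteS hq) nHermite0 nHermite1.
  rewrite !qpochS !qpoch0 !expr0 !expr1 /lq !mulr1 !mul1r.
  have n3 := n2 1%N; rewrite expr1 in n3.
  have n4 : 1 - q != 0 by rewrite lt0r_neq0// subr1q_gt0.
  rewrite -[X in X * r * z ^+ 2](sqr_sqrt1q hq).
  by field; rewrite n1 n3 n4.
rewrite big_nat_recr//= [X in _ - _ * X]big_nat_recr//=.
rewrite [X in X - _]mulrDr [X in _ - X]mulrDr opprD addrACA IH.
rewrite /rem /t !evenHermite_termE !qpoch_shift//.
rewrite !doubleS nHermite_skip.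
have h1 : qpoch q q n != 0 by rewrite lt0r_neq0// qpoch_gt0.
have h2 : 1 - q * q ^+ n != 0 by rewrite -exprS subr_eq0 eq_sym lt_eqF// ltr_qexp1.
have h2' : 1 - q * (q * q ^+ n) != 0 by rewrite -!exprS subr_eq0 eq_sym lt_eqF// ltr_qexp1.
have h3 : qpoch q r n.+1 != 0 by rewrite lt0r_neq0// qpoch_gt0.
have h4 := n2 n.+1; have h5 := n2 n.+2; rewrite !exprS in h4 h5.
rewrite ![qpoch q r n.+2]qpochS ![qpoch q r n.+3]qpochS ![qpoch q r n.+2]qpochS.
rewrite ![qpoch q q _.+1]qpochS [(r * q) ^+ _]exprMn ![q ^+ _.+1]exprS ![r ^+ _.+1]exprS.
rewrite -!muln2 !exprM /lq.
by field; rewrite ?h1 ?h2 ?h3 ?h4 ?h5 ?h2' ?n1.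
Qed.

Lemma normr_qexp_le1 n : `|q ^+ n| <= 1.
Proof. by rewrite normrX exprn_ile1// ltW. Qed.

Lemma cvg_evenHermite_rem r : `|r| < 1 -> rem r @ \oo --> (0 : R).
Proof.
move=> r1; have t0 : t r @ \oo --> (0 : R).
  by apply: cvg_series_cvg_0; exact: is_cvg_evenHermite.
rewrite -[X in _ --> X]addr0; apply: cvgD.
  apply: (@cvg0_bounded_mul _ (fun n => t r n.+1)
    (fun n => - (1 - q ^+ n.+1) * (1 - r * q ^+ n.+1)) (2 * 2)); last first.
    by rewrite cvg_shiftS.
  move=> n; rewrite normrM normrN ler_pM//.
    by rewrite (le_trans (ler_normB _ _))// normr1 -[leRHS]/(1 + 1) lerD2l normr_qexp_le1.
  rewrite (le_trans (ler_normB _ _))// normr1 -[leRHS]/(1 + 1) lerD2l.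
  exact: le_trans (normr_scaled_le hq _ _) (ltW r1).
apply: (@cvg0_bounded_mul _ (t r) _ (1 * 2 * 2 / (1 - `|r|))) => // n.
rewrite normrM normrM normrM normfV; apply: ler_pM; rewrite ?mulr_ge0 ?invr_ge0//.
  apply: ler_pM; rewrite ?mulr_ge0//.
    apply: ler_pM => //; first by rewrite normrX exprn_ile1// ltW.
    by rewrite (le_trans (ler_normD _ _))// normr1 -[leRHS]/(1 + 1) lerD2l normr_qexp_le1.
  by rewrite (le_trans (ler_normB _ _))// normr1 -[leRHS]/(1 + 1) lerD2l normr_qexp_le1.
have h0 : 0 < 1 - `|r| by rewrite subr_gt0.
have h1 := qpoch_factor_ge hq n.+1 r1.
by rewrite ger0_norm ?lef_pV2 ?posrE ?(lt_le_trans h0)// (le_trans (ltW h0)).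
Qed.

Lemma evenHermite_qdifference r : `|r| < 1 ->
  omegaq q z z r * evenHermite_sum r =
  (1 - r ^+ 2) * (1 - q * r ^+ 2) * evenHermite_sum (r * q).
Proof.
move=> r1; apply/eqP; rewrite -subr_eq0; apply/eqP.
have rq1 : `|r * q| < 1.
  by rewrite normrM (le_lt_trans _ r1)// ler_piMr// ltW.
have h : (fun n => (1 - r) ^+ 2 * rem r n) @ \oo --> (0 : R).
  by rewrite -[X in _ --> X](mulr0 ((1 - r) ^+ 2)); apply: cvgMr; exact: cvg_evenHermite_rem.
pose u n := series (t r) n.+1.
pose v n := series (t (r * q)) n.+1.
have hu : u @ \oo --> evenHermite_sum r by rewrite cvg_shiftS; exact: is_cvg_evenHermite.
have hv : v @ \oo --> evenHermite_sum (r * q) by rewrite cvg_shiftS; exact: is_cvg_evenHermite.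
have e : (fun n => (1 - r) ^+ 2 * rem r n) = (fun n => omegaq q z z r * u n) \-
    (fun n => (1 - r ^+ 2) * (1 - q * r ^+ 2) * v n).
  by apply/funext => n; rewrite -evenHermite_partial.
have huv : (fun n => (1 - r) ^+ 2 * rem r n) @ \oo --> omegaq q z z r * evenHermite_sum r -
    (1 - r ^+ 2) * (1 - q * r ^+ 2) * evenHermite_sum (r * q).
  by rewrite e; apply: cvgB; exact: cvgMr.
exact: cvg_unique (@norm_hausdorff _ _) _ _ _ _ huv h.
Qed.

Lemma cvg_evenHermite0 r : `|r| < 1 ->
  (fun n => evenHermite_sum (r * q ^+ n)) @ \oo --> (1 : R).
Proof.
move=> r1; have a01 : 0 <= `|r| < 1 by rewrite normr_ge0.
have [K [th [K0 hth hK]]] := evenHermite_term_le a01.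
have H n : `|evenHermite_sum (r * q ^+ n) - t (r * q ^+ n) 0| <= K * th / (1 - th) * `|q| ^+ n.
  rewrite mulrAC; apply: normr_lim_seriesB0 => // k.
  apply: le_trans (hK r (q ^+ n) k.+1 (lexx _) (normr_qexp_le1 n)) _.
  have -> : K * th * `|q| ^+ n * th ^+ k = K * (`|q| ^+ n * th ^+ k.+1).
    by rewrite exprS; ring.
  rewrite ler_wpM2l// exprMn ler_wpM2r ?exprn_ge0//; first by case/andP: hth.
  by rewrite normrX exprS ler_piMr// ?exprn_ge0// exprn_ile1 ?exprn_ge0// exprn_ile1// ltW.
have t1 : (fun n => t (r * q ^+ n) 0%N) @ \oo --> (1 : R).
  have -> : (fun n => t (r * q ^+ n) 0%N) = (fun n => (1 - r * q ^+ n)^-1).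
    apply/funext => n; rewrite /t /evenHermite_term qfact0 qpochS qpoch0.
    by rewrite !expr0 !mulr1 !mul1r.
  rewrite -[X in _ --> X]invr1; apply: cvgV; first exact: oner_neq0.
  rewrite -[X in _ --> X]subr0; apply: cvgB; first exact: cvg_cst.
  exact: cvg_scaled.
have d0 : (fun n => evenHermite_sum (r * q ^+ n) - t (r * q ^+ n) 0%N) @ \oo --> (0 : R).
  have g0 : (fun n => K * th / (1 - th) * `|q| ^+ n) @ \oo --> (0 : R).
    by apply: cvg_geometric; rewrite normr_id.
  apply/cvgr0Pnorm_le => e e0; move/cvgr0Pnorm_le: g0 => /(_ e e0).
  by apply: filterS => n; apply: le_trans; rewrite (le_trans (H n))// ler_norm.
have -> : (fun n => evenHermite_sum (r * q ^+ n)) =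
    (fun n => evenHermite_sum (r * q ^+ n) - t (r * q ^+ n) 0%N) \+
    (fun n => t (r * q ^+ n) 0%N).
  by apply/funext => n /=; rewrite subrK.
by rewrite -[X in _ --> X]add0r; exact: cvgD.
Qed.

(** Both sums solve the q-difference equation of the diagonal x = y = z. *)
Lemma evenHermite_sumE r : `|r| < 1 -> evenHermite_sum r = mehler q z z r.
Proof.
move=> r1; rewrite (mehlerE hq)//; apply: (qdifference_solution hq) => //.
  exact: evenHermite_qdifference.
exact: cvg_evenHermite0.
Qed.

End EvenExpansion.

(** * Closed forms of the diagonal Mehler kernel *)

Section Products.
Variables (R : realType) (q : R).
Hypothesis hq : -1 < q < 1.
Implicit Types (x z r a : R) (n k : nat).

Let q_lt1 : `|q| < 1. Proof. by case/andP: (normq_lt1 hq). Qed.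

Lemma cvg_prod_from1 (f : R ^nat) (l : R) :
  (fun n => \prod_(0 <= i < n) f i.+1) @ \oo --> l ->
  (fun n => \prod_(1 <= i < n) f i) @ \oo --> l.
Proof.
move=> h; rewrite -cvg_shiftS.
suff -> : (fun n => \prod_(1 <= i < n.+1) f i) = (fun n => \prod_(0 <= i < n) f i.+1) by [].
by apply/funext => n; rewrite big_add1.
Qed.

Lemma lq_ge x a : Sq q x -> `|a| <= 1 -> (1 - `|a|) ^+ 2 <= lq q x a.
Proof.
move=> xS a1; rewrite /lq.
have h := sqr_Sq hq xS.
have h0 : 0 <= (1 - q) * x ^+ 2 by rewrite mulr_ge0 ?sqr_ge0// ltW// subr1q_gt0.
rewrite (_ : (1 - q) * a * _ = a * ((1 - q) * x ^+ 2)); last by ring.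
move: ((1 - q) * x ^+ 2) h h0 => w w4 w0.
rewrite -subr_ge0; case: (lerP 0 a) => a0.
  rewrite (ger0_norm a0) (_ : _ - _ = a * (4 - w)); last by ring.
  by rewrite mulr_ge0// subr_ge0.
rewrite (ltr0_norm a0) (_ : _ - _ = - a * w); last by ring.
by rewrite mulr_ge0// oppr_ge0 ltW.
Qed.

Lemma lq_factor_ge x a k : Sq q x -> `|a| < 1 ->
  (1 - `|a|) ^+ 2 <= lq q x (a * q ^+ k).
Proof.
move=> xS a1; have h := normr_scaled_le hq a k.
apply: le_trans (lq_ge xS (le_trans h (ltW a1))).
by rewrite lerXn2r ?nnegrE ?lerD2l ?lerN2// subr_ge0 ?(ltW a1)// (le_trans h (ltW a1)).
Qed.

Lemma normr_lqB1 x a : Sq q x -> `|a| <= 1 -> `|lq q x a - 1| <= 7 * `|a|.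
Proof.
move=> xS a1; have h := sqr_Sq hq xS.
have h0 : 0 <= (1 - q) * x ^+ 2 by rewrite mulr_ge0 ?sqr_ge0// ltW// subr1q_gt0.
have -> : lq q x a - 1 = a * (2 + a - (1 - q) * x ^+ 2) by rewrite /lq; ring.
rewrite normrM mulrC ler_wpM2r// (le_trans (ler_normB _ _))//.
rewrite (ger0_norm h0) (_ : 7 = 3 + 4); last by ring.
rewrite lerD// (le_trans (ler_normD _ _))// normr_nat (_ : 3 = 2 + 1) ?lerD//; ring.
Qed.

Lemma normr_lq_factorB1 x a k : Sq q x -> `|a| <= 1 ->
  `|lq q x (a * q ^+ k) - 1| <= 7 * `|q| ^+ k.
Proof.
move=> xS a1; apply: le_trans (normr_lqB1 xS _) _.
  exact: le_trans (normr_scaled_le hq _ _) a1.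
by rewrite ler_wpM2l// normr_scaled.
Qed.

Lemma cvg_lq_prod x a : Sq q x -> `|a| < 1 -> exists2 l : R, 0 < l &
  (fun n => \prod_(0 <= i < n) lq q x (a * q ^+ i)) @ \oo --> l.
Proof.
move=> xS a1.
apply: (@cvg_prod_near1 _ _ 7 `|q| ((1 - `|a|) ^+ 2)); first exact: normq_lt1.
- by move=> k; apply: normr_lq_factorB1 => //; exact: ltW.
- by rewrite exprn_gt0// subr_gt0.
- by move=> k; exact: lq_factor_ge.
Qed.

Lemma cvg_lq_weight x : Sq q x ->
  exists2 l : R, 0 < l & (fun n => \prod_(1 <= i < n) lq q x (q ^+ i)) @ \oo --> l.
Proof.
move=> xS; have [l l0 hl] := cvg_lq_prod xS q_lt1.
exists l => //; apply: cvg_prod_from1.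
suff -> : (fun n => \prod_(0 <= i < n) lq q x (q ^+ i.+1)) =
   (fun n => \prod_(0 <= i < n) lq q x (q * q ^+ i)) by [].
by apply/funext => n; apply: eq_bigr => i _; rewrite exprS.
Qed.

Lemma omegaq_diag_prod z r : Sq q z -> `|r| < 1 ->
  \big[*%R/1]_(0 <= i <oo) omegaq q z z (r * q ^+ i) =
  qpochoo q r ^+ 2 * \big[*%R/1]_(0 <= i <oo) lq q z (r * q ^+ i).
Proof.
move=> zS r1; have [l l0 hl] := cvg_lq_prod zS r1.
rewrite (cvg_lim (@norm_hausdorff _ _) hl).
apply: cvg_lim => //.
have -> : (fun n => \prod_(0 <= i < n) omegaq q z z (r * q ^+ i)) =
   (fun n => qpoch q r n ^+ 2 * \prod_(0 <= i < n) lq q z (r * q ^+ i)).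
  apply/funext => n; rewrite qpochE expr2 -!big_split/=.
  by apply: eq_bigr => i _; rewrite omegaq_diag; ring.
by apply: cvgM => //; rewrite expr2; apply: cvgM; exact: cvg_qpoch.
Qed.

Lemma form_squares_conditional r z : Sq q z -> `|r| < 1 ->
  form_squares q r z = form_conditional q r z.
Proof.
move=> zS r1; rewrite /form_squares /form_conditional /fCN sqHermite_termE.
by rewrite -(mehlerE hq zS zS r1) [RHS]mulrA.
Qed.

Lemma form_conditional_product r z : Sq q z -> `|r| < 1 ->
  form_conditional q r z = form_product q r z.
Proof.
by move=> zS r1; rewrite /form_conditional /form_product /fCN omegaq_diag_prod// [LHS]mulrA.
Qed.

Lemma form_squares_even r z : Sq q z -> `|r| < 1 ->
  form_squares q r z = form_even q r z.
Proof.
move=> zS r1; rewrite /form_squares /form_even sqHermite_termE.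
by rewrite -[limn (series (evenHermite_term _ _ _))]/(evenHermite_sum q z r) evenHermite_sumE.
Qed.

Lemma qpochooS a : qpochoo q a = (1 - a) * qpochoo q (a * q).
Proof.
apply: cvg_lim => //; rewrite -cvg_shiftS.
have -> : (fun n => \prod_(0 <= k < n.+1) (1 - a * q ^+ k)) =
    (fun n => (1 - a) * qpoch q (a * q) n).
  apply/funext => n; rewrite big_nat_recl//= expr0 mulr1 qpochE.
  by congr (_ * _); apply: eq_bigr => i _; rewrite exprS mulrA.
by apply: cvgMr; exact: cvg_qpoch.
Qed.

Lemma form_product_explicit r z : Sq q z -> `|r| < 1 ->
  form_product q r z = form_explicit q r z.
Proof.
move=> zS r1; rewrite /form_product /form_explicit /fN.
have [W W0 hW] := cvg_lq_weight zS.
have rq1 : `|r * q| < 1 by rewrite normrM (le_lt_trans _ r1)// ler_piMr// ltW.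
have [L L0 hL] := cvg_lq_prod zS rq1.
have hl0 : 0 < lq q z r.
  apply: lt_le_trans (lq_ge zS (ltW r1)); by rewrite exprn_gt0// subr_gt0.
have hL' : (fun n => \prod_(1 <= i < n) lq q z (r * q ^+ i)) @ \oo --> L.
  apply: cvg_prod_from1.
  suff -> : (fun n => \prod_(0 <= i < n) lq q z (r * q ^+ i.+1)) =
     (fun n => \prod_(0 <= i < n) lq q z (r * q * q ^+ i)) by [].
  by apply/funext => n; apply: eq_bigr => i _; rewrite exprS mulrA.
have -> : \big[*%R/1]_(0 <= i <oo) lq q z (r * q ^+ i) = lq q z r * L.
  apply: cvg_lim => //; rewrite -cvg_shiftS.
  have -> : (fun n => \prod_(0 <= k < n.+1) lq q z (r * q ^+ k)) =
      (fun n => lq q z r * \prod_(1 <= k < n.+1) lq q z (r * q ^+ k)).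
    by apply/funext => n; rewrite big_ltn//= expr0 mulr1.
  by apply: cvgMr; move: hL'; rewrite -cvg_shiftS.
have -> : \big[*%R/1]_(1 <= j <oo) (lq q z (q ^+ j) / lq q z (r * q ^+ j)) = W / L.
  apply: cvg_lim => //.
  have -> : (fun n => \prod_(1 <= j < n) (lq q z (q ^+ j) / lq q z (r * q ^+ j))) =
    (fun n => (\prod_(1 <= j < n) lq q z (q ^+ j)) * (\prod_(1 <= j < n) lq q z (r * q ^+ j))^-1).
    by apply/funext => n; rewrite big_split/= prodfV.
  by apply: cvgM => //; apply: cvgV => //; exact: lt0r_neq0.
rewrite (cvg_lim (@norm_hausdorff _ _) hW) (qpochooS (r ^+ 2)) (qpochooS r).
have h1 := lt0r_neq0 (qpochoo_gt0 hq rq1).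
have h2 : 1 - r != 0 by rewrite subr_eq0 eq_sym lt_eqF// (le_lt_trans (ler_norm r)).
have h3 := lt0r_neq0 hl0; have h4 := lt0r_neq0 L0; have h5 := lt0r_neq0 (pi_gt0 R).
by move: (pi : R) h5 => p h5; field; rewrite h1 h2 h3 h4 h5.
Qed.

End Products.

(** * Integrals of products of sines *)

Section FourierPrimitive.
Variable R : realType.

(** A primitive of cos (k x); the case k = 0 avoids the division by k. *)
Definition cosine_primitive (k : nat) (x : R) : R :=
  if k is 0%N then x else sin (k%:R * x) / k%:R.

Lemma is_derive_cosine_primitive k (x : R) :
  is_derive x 1 (cosine_primitive k) (cos (k%:R * x)).
Proof.
case: k => [|k].
  by rewrite mul0r cos0 /cosine_primitive; exact: is_derive_id.
have hz : is_derive x 1 (k.+1%:R \*: @id R) (k.+1%:R *: 1 : R).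
  exact: is_deriveZ.
have hs := @is_derive1_comp _ (@sin R) _ _ _ _ (is_derive_sin _) hz.
have hd : is_derive x 1 (k.+1%:R^-1 \*: (@sin R \o (k.+1%:R \*: @id R)))
   (k.+1%:R^-1 *: (cos (k.+1%:R * x) * (k.+1%:R *: 1)) : R).
  exact: is_deriveZ.
have -> : cosine_primitive k.+1 = k.+1%:R^-1 \*: (@sin R \o (k.+1%:R \*: @id R)).
  by apply/funext => y; rewrite /cosine_primitive mulrC.
by apply: is_derive_eq hd _; rewrite /GRing.scale/= mulr1 mulrC mulfK// pnatr_eq0.
Qed.

Lemma sin_natpi k : sin (k%:R * pi) = 0 :> R.
Proof.
elim: k => [|k IH]; first by rewrite mul0r sin0.
by rewrite -natr1 mulrDl mul1r sinD IH sinpi mul0r mulr0 addr0.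
Qed.

Lemma cosine_primitive_pi k : cosine_primitive k pi - cosine_primitive k 0 = (k == 0%N)%:R * pi :> R.
Proof.
case: k => [|k] /=; first by rewrite subr0 mul1r.
by rewrite sin_natpi mulr0 sin0 !mul0r subr0.
Qed.

Lemma derivable_oo_LRcontinuous_everywhere (F f : R -> R) (a b : R) :
  (forall x : R, is_derive x 1 F (f x)) -> derivable_oo_LRcontinuous F a b.
Proof.
move=> dF; have cF x : {for x, continuous F}.
  by apply: differentiable_continuous; apply/derivable1_diffP.
split; [by move=> x _|apply: cvg_at_right_filter; exact: cF|].
by apply: cvg_at_left_filter; exact: cF.
Qed.

(** The integrand is (cos (m x) - cos ((m + 2) x)) / pi, and of the two
    primitives only the one of cos (0 x) contributes. *)
Lemma integral_sin_sinmul m :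
  (\int[lebesgue_measure]_(x in `[0%R, pi]) (2 / pi * (sin x * sin (m.+1%:R * x)))%:E
   = ((m == 0%N)%:R : R)%:E)%E.
Proof.
pose F x : R := pi^-1 * (cosine_primitive m x - cosine_primitive m.+2 x).
have pi0 := lt0r_neq0 (pi_gt0 R).
have dF (x : R) : is_derive x 1 F (2 / pi * (sin x * sin (m.+1%:R * x))).
  have h1 := is_derive_cosine_primitive m x; have h2 := is_derive_cosine_primitive m.+2 x.
  have h3 : is_derive x 1 F (pi^-1 *: (cos (m%:R * x) - cos (m.+2%:R * x))).
    exact: is_deriveZ.
  apply: is_derive_eq; rewrite /GRing.scale/=.
  have -> : m%:R * x = m.+1%:R * x - x by rewrite -[m.+1%:R]natr1; ring.
  have -> : m.+2%:R * x = m.+1%:R * x + x by rewrite -[m.+2%:R]natr1; ring.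
  by rewrite cosB cosD; move: (pi : R) pi0 => p p0; field.
rewrite (@continuous_FTC2 _ _ F).
- rewrite -EFinB /F -mulrBr opprB addrACA [X in _ * X](_ : _ =
    (cosine_primitive m pi - cosine_primitive m 0) - (cosine_primitive m.+2 pi - cosine_primitive m.+2 0)); last by ring.
  by rewrite !cosine_primitive_pi mul0r subr0 mulrC mulfK.
- exact: pi_gt0.
- apply: continuous_subspaceT => x.
  apply: (@continuousM _ _ (fun=> 2 / pi) (fun x => sin x * sin (m.+1%:R * x))).
    exact: cvg_cst.
  apply: continuousM; first exact: continuous_sin.
  apply: continuous_comp; last exact: continuous_sin.
  by apply: continuousM; [exact: cvg_cst|exact: cvg_id].
- exact: derivable_oo_LRcontinuous_everywhere dF.
- by move=> x _; rewrite derive1E derive_val.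
Qed.

End FourierPrimitive.

(** * Gaussian binomials *)

Section GaussianBinomial.
Variables (R : realType) (q : R).
Hypothesis hq : -1 < q < 1.

(** Gaussian binomial coefficients, by their Pascal recursion. The value 0 for
    n < k spares case distinctions at the ends of finite products. *)
Fixpoint gbin (n k : nat) : R :=
  match n, k with
  | _, 0%N => 1
  | 0%N, _.+1 => 0
  | n.+1, k.+1 => gbin n k + q ^+ k.+1 * gbin n k.+1
  end.

Lemma gbin0 n : gbin n 0 = 1. Proof. by case: n. Qed.

Lemma gbinS n k : gbin n.+1 k.+1 = gbin n k + q ^+ k.+1 * gbin n k.+1.
Proof. by []. Qed.

Lemma gbin_small n k : (n < k)%N -> gbin n k = 0.
Proof.
elim: n k => [|n IH] [|k]//; rewrite ltnS => nk.
by rewrite gbinS !IH ?mulr0 ?addr0// ltnW.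
Qed.

Lemma gbinS_dual n k : (k <= n)%N ->
  gbin n.+1 k.+1 = q ^+ (n - k) * gbin n k + gbin n k.+1.
Proof.
elim: n k => [|n IH] k; first by case: k => // _; rewrite /= !mulr0 addr0 addr0 expr0 mulr1.
rewrite leq_eqVlt => /predU1P[->|kn].
  rewrite subnn expr0 mul1r [LHS]gbinS.
  by rewrite (@gbin_small n.+1 n.+2)// mulr0.
rewrite gbinS; case: k kn => [|k] kn.
  rewrite !gbin0 subn0 mulr1 expr1 [X in _ + q * X](IH 0%N isT) [gbin n.+1 1]gbinS.
  by rewrite !gbin0 subn0 expr1 exprS; ring.
rewrite [in LHS]IH; last exact: ltnW.
rewrite [X in _ + _ * X]IH// [in RHS]gbinS [gbin n.+1 k.+2]gbinS.
have -> : (n.+1 - k.+1 = n - k)%N by rewrite subSS.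
have -> : (n - k = (n - k.+1).+1)%N by rewrite subnSK.
rewrite [q ^+ (n - k.+1).+1]exprS [q ^+ k.+2]exprS; ring.
Qed.

(** Both Pascal recursions, one after the other: the form in which a factor
    l_q(x | a) acts on the coefficients. *)
Lemma gbinSS n k : (k <= n)%N -> gbin n.+2 k.+2 =
  q ^+ (n - k) * gbin n k + (1 + q ^+ n.+1) * gbin n k.+1 + q ^+ k.+2 * gbin n k.+2.
Proof.
move=> kn; rewrite gbinS gbinS_dual//.
move: kn; rewrite leq_eqVlt => /predU1P[->|kn].
  by rewrite (@gbin_small n n.+1)// (@gbin_small n n.+2)// (@gbin_small n.+1 n.+2)//; ring.
rewrite gbinS_dual// mulrDr mulrA -exprD.
have -> : (k.+2 + (n - k.+1) = n.+1)%N by rewrite addSn subnKC.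
ring.
Qed.

Lemma gbin_qpoch n k : (k <= n)%N ->
  gbin n k * (qpoch q q k * qpoch q q (n - k)) = qpoch q q n.
Proof.
elim: n k => [|n IH] [|k]; rewrite ?gbin0 ?qpoch0 ?mul1r ?subn0 ?mulr1//.
rewrite ltnS leq_eqVlt => /predU1P[->|kn].
  rewrite gbinS (@gbin_small n n.+1)// mulr0 addr0 subnn qpoch0 mulr1 qpochS mulrA.
  by rewrite -[in RHS](IH n (leqnn n)) subnn qpoch0 mulr1.
have h1 := IH k (ltnW kn); have h2 := IH k.+1 kn.
rewrite gbinS subSS mulrDl.
have -> : gbin n k * (qpoch q q k.+1 * qpoch q q (n - k)) = qpoch q q n * (1 - q ^+ k.+1).
  by rewrite -h1 qpochS exprS; ring.
have -> : q ^+ k.+1 * gbin n k.+1 * (qpoch q q k.+1 * qpoch q q (n - k)) =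
    q ^+ k.+1 * (1 - q ^+ (n - k)) * qpoch q q n.
  have e : (n - k = (n - k.+1).+1)%N by rewrite subnSK.
  by rewrite -h2 e [qpoch q q (n - k.+1).+1]qpochS [q ^+ (n - k.+1).+1]exprS; ring.
have e : q ^+ k.+1 * q ^+ (n - k) = q ^+ n.+1.
  by rewrite -exprD addSn subnKC// ltnW.
by rewrite qpochS -exprS -e; ring.
Qed.

Lemma gbin_sym n k : (k <= n)%N -> gbin n (n - k) = gbin n k.
Proof.
move=> kn; have := gbin_qpoch kn; have := gbin_qpoch (leq_subr k n).
rewrite subKn// [X in _ * X = _ -> _]mulrC => <- /mulIf; move=> -> //.
by rewrite mulf_neq0// lt0r_neq0// qpoch_gt0//; case/andP: (normq_lt1 hq).
Qed.

End GaussianBinomial.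

(** * Chebyshev polynomials and the semicircle density *)

Section Semicircle.
Variables (R : realType) (q : R).
Hypothesis hq : -1 < q < 1.
Notation mu := (@lebesgue_measure R).
Let s := Num.sqrt (1 - q).

Let s0 : 0 < s. Proof. by rewrite sqrt1q_gt0. Qed.

Definition semicircle (x : R) : R :=
  s * Num.sqrt (4 - (1 - q) * x ^+ 2) / (2 * pi).

(** Chebyshev polynomials of the second kind in sqrt (1 - q) x / 2. *)
Fixpoint cheb (n : nat) : {poly R} :=
  match n with
  | 0%N => 1
  | m.+1 => s%:P * 'X * cheb m - match m with 0%N => 0 | p.+1 => cheb p end
  end.

Lemma chebS n : cheb n.+2 = s%:P * 'X * cheb n.+1 - cheb n.
Proof. by []. Qed.

Lemma cheb0 : cheb 0 = 1. Proof. by []. Qed.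

Lemma cheb1 : cheb 1 = s%:P * 'X.
Proof. by rewrite /= mulr1 subr0. Qed.

Lemma horner_cheb1 x : (cheb 1).[x] = s * x.
Proof. by rewrite cheb1 hornerM hornerC hornerX. Qed.

Lemma horner_chebS n x : (cheb n.+2).[x] = s * x * (cheb n.+1).[x] - (cheb n).[x].
Proof. by rewrite chebS hornerD hornerN !hornerM hornerC hornerX. Qed.

Lemma cheb_sin m (t : R) : (cheb m).[2 / s * cos t] * sin t = sin (m.+1%:R * t).
Proof.
have ss : s * (2 / s * cos t) = 2 * cos t.
  by rewrite mulrA mulrCA divff ?mulr1// lt0r_neq0.
suff H n : (cheb n).[2 / s * cos t] * sin t = sin (n.+1%:R * t) /\
   (cheb n.+1).[2 / s * cos t] * sin t = sin (n.+2%:R * t) by case: (H m).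
elim: n => [|n [IH1 IH2]].
  split; first by rewrite hornerC !mul1r.
  by rewrite horner_cheb1 ss [2 * t]mulr_natl sin_mulr2n; ring.
split=> //; rewrite horner_chebS ss mulrBl -(mulrA (2 * cos t)) IH1 IH2.
have -> : n.+1%:R * t = n.+2%:R * t - t by rewrite -[n.+2%:R]natr1; ring.
have -> : n.+3%:R * t = n.+2%:R * t + t by rewrite -[n.+3%:R]natr1; ring.
by rewrite sinB sinD; ring.
Qed.

Lemma continuous_semicircle : continuous semicircle.
Proof.
move=> x; rewrite /semicircle; apply: cvgMl; apply: cvgMr.
apply: (@cvg_comp _ _ _ (fun x => 4 - (1 - q) * x ^+ 2) Num.sqrt _
  (nbhs (4 - (1 - q) * x ^+ 2))); last exact: sqrt_continuous.
apply: cvgB; first exact: cvg_cst.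
by apply: cvgMr; exact: exprn_continuous.
Qed.

(** The substitution x = 2 cos t / sqrt (1 - q) turns both the density and the
    polynomial into sines. *)
Lemma integral_semicircle_cheb m :
  (\int[mu]_(x in Sq q) (semicircle x * (cheb m).[x])%:E = ((m == 0%N)%:R : R)%:E)%E.
Proof.
pose F (t : R) : R := 2 / s * cos t.
have F0 : F 0 = 2 / s by rewrite /F cos0 mulr1.
have Fpi : F pi = - (2 / s) by rewrite /F cospi mulrN1.
have dF (t : R) : is_derive t 1 F (- (2 / s) * sin t).
  have h : is_derive t 1 ((2 / s) \*: @cos R) ((2 / s) *: (- sin t) : R).
    exact: is_deriveZ.
  by apply: is_derive_eq h _; rewrite /GRing.scale/= mulrN mulNr.
have F'E : (F^`())%classic = (fun t => - (2 / s) * sin t).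
  by apply/funext => t; rewrite derive1E; exact: (@derive_val _ _ _ _ _ _ _ (dF t)).
have cF' : continuous (F^`())%classic.
  by rewrite F'E => t; apply: cvgMr; exact: continuous_sin.
have -> : Sq q = `[F pi, F 0]%classic by rewrite Fpi F0.
rewrite integration_by_substitution_decreasing.
- rewrite -integral_sin_sinmul; apply: eq_integral => t.
  rewrite inE/= in_itv/= => t0pi; congr EFin.
  rewrite F'E -[LHS]/(semicircle (F t) * (cheb m).[F t] * - (- (2 / s) * sin t)).
  rewrite mulNr opprK /semicircle.
  (* the square root of this is 2 sin t, as sin is nonnegative on [0, pi] *)
  have -> : 4 - (1 - q) * F t ^+ 2 = (2 * sin t) ^+ 2.
    rewrite -(sqr_sqrt1q hq) /F -/s !exprMn exprVn sin2cos2.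
    by have := lt0r_neq0 s0 => ?; field.
  rewrite sqrtr_sqr ger0_norm; last by rewrite mulr_ge0// sin_ge0_pi.
  rewrite -cheb_sin -/(F t).
  have h1 := lt0r_neq0 s0; have h2 := lt0r_neq0 (pi_gt0 R).
  by move: (pi : R) h2 => p h2; field; rewrite h1 h2.
- exact: pi_ge0.
- move=> x y x0 y0 xy; rewrite /F ltr_pM2l ?divr_gt0//.
  by rewrite (ltr_cos y0 x0).
- by move=> t _; exact: cF'.
- by apply: cvgP; apply: cvg_at_right_filter; exact: cF'.
- by apply: cvgP; apply: cvg_at_left_filter; exact: cF'.
- exact: derivable_oo_LRcontinuous_everywhere dF.
- apply: continuous_subspaceT => x; apply: cvgM.
    exact: continuous_semicircle.
  exact: continuous_horner.
Qed.

End Semicircle.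

(** * Bounded convergence *)

Lemma normr_cvg_le (R : realType) (u : R ^nat) (l M : R) :
  u @ \oo --> l -> (forall n, `|u n| <= M) -> `|l| <= M.
Proof.
move=> ul uM; have h : `|u n| @[n --> \oo] --> `|l| by exact: cvg_norm.
rewrite -(cvg_lim (@norm_hausdorff _ _) h); apply: limr_le.
  by apply/cvg_ex; exists `|l|.
by near=> n; exact: uM.
Unshelve. all: by end_near.
Qed.

Section BoundedConvergence.
Context d (T : measurableType d) (R : realType) (mu : {measure set T -> \bar R}).
Variables (D : set T) (mD : measurable D) (muD : (mu D < +oo)%E).

Lemma bounded_measurable_integrable (f : T -> R) (M : R) :
  measurable_fun D f -> (forall x, D x -> `|f x| <= M) ->
  mu.-integrable D (EFin \o f).
Proof.
move=> mf fM; apply: measurable_bounded_integrable => //.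
exists M; split; first exact: num_real.
by move=> y My x Dx /=; apply: le_trans (fM x Dx) (ltW My).
Qed.

Lemma bounded_convergence (f_ : (T -> R) ^nat) (f : T -> R) (M : R) :
  (forall n, measurable_fun D (f_ n)) ->
  (forall n x, D x -> `|f_ n x| <= M) ->
  (forall x, D x -> f_ ^~ x @ \oo --> f x) ->
  (fun n => \int[mu]_(x in D) f_ n x) @ \oo --> \int[mu]_(x in D) f x.
Proof.
move=> mf fM ff.
have mlim : measurable_fun D f := measurable_fun_cvg mf ff.
have fM' x : D x -> `|f x| <= M.
  by move=> Dx; apply: normr_cvg_le (ff x Dx) _ => n; exact: fM.
have intf := bounded_measurable_integrable mlim fM'.
have [_ _ h] : [/\ mu.-integrable D (EFin \o f),
    [sequence (\int[mu]_(x in D) `|(f_ n x)%:E - (f x)%:E|)%E]_n @ \oo --> 0%E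
  & [sequence (\int[mu]_(x in D) (f_ n x)%:E)%E]_n @ \oo -->
    (\int[mu]_(x in D) (f x)%:E)%E].
  apply: (@dominated_convergence _ _ _ mu D mD (fun n x => (f_ n x)%:E)
     (EFin \o f) (fun=> M%:E)).
  - by move=> n; apply/measurable_EFinP; exact: mf.
  - exact/measurable_EFinP.
  - apply: aeW => x Dx; apply: cvg_EFin; first exact: nearW.
    exact: ff.
  - by apply: (@bounded_measurable_integrable (fun=> M) `|M|).
  - by apply: aeW => x n Dx; rewrite lee_fin fM.
rewrite /Rintegral; apply: fine_cvg.
by rewrite fineK// integrable_fin_num.
Qed.

End BoundedConvergence.

(** * Integrals of polynomials against the q-Hermite weight *)

Section WeightedIntegral.
Variables (R : realType) (q : R).
Hypothesis hq : -1 < q < 1.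
Notation mu := (@lebesgue_measure R).

Lemma measurable_Sq : measurable (Sq q). Proof. exact: measurable_itv. Qed.

Lemma lebesgue_Sq_lty : (mu (Sq q) < +oo)%E.
Proof. by rewrite lebesgue_measure_itv/=; case: ifP => _; rewrite ?ltry// ltry. Qed.

Lemma poly_bounded_Sq (p : {poly R}) :
  exists M : R, forall x, Sq q x -> `|p.[x]| <= M.
Proof.
elim/poly_ind: p => [|p c [M hM]]; first by exists 0 => x _; rewrite horner0 normr0.
exists (M * (2 / Num.sqrt (1 - q)) + `|c|) => x xS.
rewrite hornerMXaddC (le_trans (ler_normD _ _))// lerD2r normrM ler_pM//.
  exact: hM.
by move: xS; rewrite /Sq/= in_itv/= ler_norml.
Qed.

Definition bounded_weight (w : R -> R) :=
  measurable_fun (Sq q) w /\ exists M : R, forall x, Sq q x -> `|w x| <= M.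

Definition wint (w : R -> R) (p : {poly R}) : R :=
  \int[mu]_(x in Sq q) (w x * p.[x]).

Section Linear.
Variables (w : R -> R) (hw : bounded_weight w).

Lemma measurable_wint p : measurable_fun (Sq q) (fun x => w x * p.[x]).
Proof.
apply: measurable_funM; first by case: hw.
apply: measurable_funTS; apply: continuous_measurable_fun; exact: continuous_horner.
Qed.

Lemma integrable_wint p : mu.-integrable (Sq q) (EFin \o (fun x => w x * p.[x])).
Proof.
have [_ [M hM]] := hw; have [M' hM'] := poly_bounded_Sq p.
apply: (@bounded_measurable_integrable _ _ _ mu _ measurable_Sq lebesgue_Sq_lty (fun x => w x * p.[x]) (M * M')).
  exact: measurable_wint.
by move=> x xS; rewrite normrM ler_pM ?hM ?hM'.
Qed.

Lemma wintD p1 p2 : wint w (p1 + p2) = wint w p1 + wint w p2.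
Proof.
rewrite /wint -RintegralD//; [|exact: measurable_Sq|exact: integrable_wint|exact: integrable_wint].
by apply: eq_Rintegral => x _; rewrite hornerD mulrDr.
Qed.

Lemma wintZ c p : wint w (c%:P * p) = c * wint w p.
Proof.
rewrite /wint -RintegralZl//; [|exact: measurable_Sq|exact: integrable_wint].
by apply: eq_Rintegral => x _; rewrite hornerM hornerC mulrCA.
Qed.

Lemma wint0 : wint w 0 = 0.
Proof. by rewrite -(mul0r 0) -[X in X * 0]/(0%:P) wintZ mul0r. Qed.

Lemma wintB p1 p2 : wint w (p1 - p2) = wint w p1 - wint w p2.
Proof.
by rewrite wintD -[- p2]mul1r mulrN -mulNr -polyCN wintZ mulN1r.
Qed.

Lemma wint_sum n (f : nat -> {poly R}) :
  wint w (\sum_(0 <= i < n) f i) = \sum_(0 <= i < n) wint w (f i).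
Proof.
elim: n => [|n IH]; first by rewrite !big_nil wint0.
by rewrite !big_nat_recr//= wintD IH.
Qed.

End Linear.

Lemma normr_semicircle x : `|semicircle q x| <= Num.sqrt (1 - q) * 2 / (2 * pi).
Proof.
rewrite ger0_norm; last first.
  by rewrite divr_ge0 ?mulr_ge0// pi_ge0.
rewrite ler_wpM2r ?invr_ge0 ?mulr_ge0 ?pi_ge0// ler_wpM2l//.
rewrite -[leRHS]ger0_norm// -sqrtr_sqr ler_wsqrtr//.
rewrite (_ : 2 ^+ 2 = 4); last by ring.
by rewrite gerBl mulr_ge0 ?sqr_ge0// ltW// subr1q_gt0.
Qed.

Lemma bounded_weight_semicircle : bounded_weight (semicircle q).
Proof.
split; last by eexists => x _; exact: normr_semicircle.
apply: measurable_funTS; apply: continuous_measurable_fun.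
exact: continuous_semicircle.
Qed.

Definition lqPoly (a : R) : {poly R} :=
  (1 + a%:P) ^+ 2 - a%:P * (Num.sqrt (1 - q))%:P ^+ 2 * 'X^2.

Lemma horner_lqPoly a x : (lqPoly a).[x] = lq q x a.
Proof.
rewrite /lqPoly /lq !(hornerD, hornerN, hornerM, horner_exp, hornerC, hornerX).
by rewrite -expr2 -[_ * Num.sqrt _]expr2 sqr_sqrt1q//; ring.
Qed.

(** Partial products of the infinite product in [fN q], as polynomials so that
    they act on the basis [cheb]. *)
Definition weightPoly N : {poly R} := \prod_(1 <= i < N.+1) lqPoly (q ^+ i).

Lemma weightPolyS N : weightPoly N.+1 = weightPoly N * lqPoly (q ^+ N.+1).
Proof. by rewrite /weightPoly big_nat_recr. Qed.

Lemma horner_weightPoly N x :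
  (weightPoly N).[x] = \prod_(1 <= i < N.+1) lq q x (q ^+ i).
Proof.
rewrite /weightPoly horner_prod; apply: eq_bigr => i _; exact: horner_lqPoly.
Qed.

(** On the scaled interval l_q(x | a) is 1 + a^2 - 2 a cos (2 t), and
    multiplication by 2 cos (2 t) shifts the index of V_m by 2 both ways.
    Reflection at the end, V_(-1) = 0 and V_(-2) = - V_0, gives the two
    exceptional cases. *)
Lemma lqPoly_cheb a m : lqPoly a * cheb q m.+2 =
  (1 + a ^+ 2)%:P * cheb q m.+2 - a%:P * (cheb q m.+4 + cheb q m).
Proof.
by rewrite /lqPoly !chebS polyCD polyC1 rmorphXn/=; ring.
Qed.

Lemma lqPoly_cheb0 a : lqPoly a * cheb q 0 =
  (1 + a ^+ 2)%:P * cheb q 0 - a%:P * (cheb q 2 - cheb q 0).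
Proof. by rewrite /lqPoly !chebS cheb1 cheb0 polyCD polyC1 rmorphXn/=; ring. Qed.

Lemma lqPoly_cheb1 a : lqPoly a * cheb q 1 =
  (1 + a ^+ 2)%:P * cheb q 1 - a%:P * cheb q 3.
Proof. by rewrite /lqPoly !chebS cheb1 cheb0 polyCD polyC1 rmorphXn/=; ring. Qed.

Lemma wint_semicircle_cheb m : wint (semicircle q) (cheb q m) = (m == 0%N)%:R.
Proof. by rewrite /wint /Rintegral integral_semicircle_cheb. Qed.

Let L N p := wint (semicircle q) (weightPoly N * p).

Let LZ N c p : L N (c%:P * p) = c * L N p.
Proof. by rewrite /L mulrCA wintZ//; exact: bounded_weight_semicircle. Qed.

Let LB N p1 p2 : L N (p1 - p2) = L N p1 - L N p2.
Proof. by rewrite /L mulrBr wintB//; exact: bounded_weight_semicircle. Qed.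

Let LD N p1 p2 : L N (p1 + p2) = L N p1 + L N p2.
Proof. by rewrite /L mulrDr wintD//; exact: bounded_weight_semicircle. Qed.

Let LS N p : L N.+1 p = L N (lqPoly (q ^+ N.+1) * p).
Proof. by rewrite /L weightPolyS mulrA. Qed.

Let LSS N m : L N.+1 (cheb q m.+2) = (1 + (q ^+ N.+1) ^+ 2) * L N (cheb q m.+2)
  - q ^+ N.+1 * (L N (cheb q m.+4) + L N (cheb q m)).
Proof.
rewrite LS lqPoly_cheb; move: (cheb q m.+2) (cheb q m.+4) (cheb q m) => A B C.
by rewrite LB !LZ LD.
Qed.

Let LS0 N : L N.+1 (cheb q 0) = (1 + (q ^+ N.+1) ^+ 2) * L N (cheb q 0)
  - q ^+ N.+1 * (L N (cheb q 2) - L N (cheb q 0)).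
Proof.
rewrite LS lqPoly_cheb0; move: (cheb q 2) (cheb q 0) => A B.
by rewrite LB !LZ LB.
Qed.

Let LS1 N : L N.+1 (cheb q 1) = (1 + (q ^+ N.+1) ^+ 2) * L N (cheb q 1)
  - q ^+ N.+1 * L N (cheb q 3).
Proof.
rewrite LS lqPoly_cheb1; move: (cheb q 1) (cheb q 3) => A B.
by rewrite LB !LZ.
Qed.

Lemma finite_weight_cheb_odd N k : wint (semicircle q) (weightPoly N * cheb q k.*2.+1) = 0.
Proof.
rewrite -/(L _ _); elim: N k => [|N IH] k.
  by rewrite /L /weightPoly big_nil mul1r wint_semicircle_cheb.
case: k => [|k].
  by have h0 := IH 0%N; have h1 := IH 1%N; rewrite LS1 h0 h1 !mulr0 subrr.
have h0 := IH k; have h1 := IH k.+1; have h2 := IH k.+2; rewrite !doubleS in h1 h2 *.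
by rewrite LSS h0 h1 h2 addr0 !mulr0 subrr.
Qed.

(** A finite form of the Jacobi triple product: by [lqPoly_cheb] the passage
    from N to N + 1 is the double Pascal step [gbinSS]. At k = 0 the reflected
    term is the right one by the symmetry of the binomials. *)
Lemma finite_weight_cheb_even N k : wint (semicircle q) (weightPoly N * cheb q k.*2) =
  (-1) ^+ k * q ^+ 'C(k.+1, 2) * gbin q N.*2.+1 (N + k).+1.
Proof.
rewrite -/(L _ _); elim: N k => [|N IH] k.
  rewrite /L /weightPoly big_nil mul1r wint_semicircle_cheb.
  case: k => [|k]; last by rewrite gbin_small ?mulr0.
  by rewrite /= expr0 !mul1r mulr0 addr0.
case: k => [|k].
  have h0 := IH 0%N; have h1 := IH 1%N; rewrite LS0 h0 h1.
  rewrite !expr0 !addn0 addn1 expr1 doubleS gbinSS; last by rewrite -addnn -addSn leq_addl.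
  have e : gbin q N.*2.+1 N = gbin q N.*2.+1 N.+1.
    rewrite -(gbin_sym hq (n := N.*2.+1) (k := N.+1)); last by rewrite ltnS -addnn leq_addl.
    by rewrite subSS -addnn addnK.
  have e2 : (N.*2.+1 - N = N.+1)%N by rewrite -addnn -addnS addKn.
  have e3 : q ^+ N.*2.+2 = (q ^+ N.+1) ^+ 2 by rewrite -exprM muln2 doubleS.
  by rewrite e e2 e3 binn expr1 [q ^+ N.+2]exprS; ring.
have h1 := IH k.+1; have h2 := IH k.+2; have h0 := IH k.
rewrite !doubleS in h1 h2 *.
rewrite LSS h0 h1 h2.
have b1 : 'C(k.+2, 2) = ('C(k.+1, 2) + k.+1)%N by rewrite binS bin1.
have b2 : 'C(k.+3, 2) = ('C(k.+1, 2) + k.+1 + k.+2)%N by rewrite binS bin1 b1.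
rewrite b1 b2 !addnS !addSn; move: 'C(k.+1, 2) {b1 b2 h0 h1 h2 IH} => c.
(* beyond k = N all the binomials vanish *)
have [kN|kN] := leqP k N; last first.
  by rewrite !gbin_small ?mulr0 ?addr0 ?mulr0 ?subrr// -addnn; lia.
rewrite gbinSS; last by rewrite -addnn ltnS leq_add2l.
have -> : (N.*2.+1 - (N + k).+1 = N - k)%N by rewrite subSS -addnn subnDl.
have e1 : q ^+ k.+1 * q ^+ (N - k) = q ^+ N.+1 by rewrite -exprD addSn subnKC.
have e2 : q ^+ N.*2.+2 = (q ^+ N.+1) ^+ 2 by rewrite -exprM muln2 doubleS.
have e3 : q ^+ (N + k).+3 = q ^+ N.+1 * q ^+ k.+2.
  by rewrite -exprD addnS addnS addSn.
have e4 : q ^+ (c + k).+1 = q ^+ c * q ^+ k.+1 by rewrite -exprD addnS.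
have e5 : q ^+ (c + k + k).+3 = q ^+ c * q ^+ k.+1 * q ^+ k.+2.
  by rewrite -!exprD; congr (q ^+ _); lia.
rewrite e2 e3 e4 e5 -e1 [(-1) ^+ k.+2]exprS [(-1) ^+ k.+1]exprS.
move: (gbin q _ (N + k).+1) (gbin q _ (N + k).+2) (gbin q _ (N + k).+3) => G1 G2 G3.
move: (q ^+ (N - k)) (q ^+ c) (q ^+ k.+1) (q ^+ k.+2) ((-1) ^+ k) => B C A D E.
ring.
Qed.

Lemma cvg_gbin_central k :
  (fun N => gbin q N.*2.+1 (N + k).+1) @ \oo --> (qpochoo q q)^-1.
Proof.
have q_lt1 : `|q| < 1 by case/andP: (normq_lt1 hq).
have c1 : (fun N => qpoch q q N.*2.+1) @ \oo --> qpochoo q q.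
  apply: (@cvg_comp _ _ _ (fun N => N.*2.+1) _ _ _ _ _ (@cvg_qpoch _ _ hq q)).
  apply/cvgnyPge => A; near=> n; rewrite -addnn (@leq_trans n)//.
    by near: n; exact: nbhs_infty_ge.
  by rewrite ltnW// ltnS leq_addl.
have c2 : (fun N => qpoch q q (N + k).+1) @ \oo --> qpochoo q q.
  apply: (@cvg_comp _ _ _ (fun N => (N + k).+1) _ _ _ _ _ (@cvg_qpoch _ _ hq q)).
  apply/cvgnyPge => A; near=> n; rewrite (@leq_trans n)//.
    by near: n; exact: nbhs_infty_ge.
  by rewrite ltnW// ltnS leq_addr.
have c3 : (fun N => qpoch q q (N - k)) @ \oo --> qpochoo q q.
  apply: (@cvg_comp _ _ _ (fun N => (N - k)%N) _ _ _ _ _ (@cvg_qpoch _ _ hq q)).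
  apply/cvgnyPge => A; near=> n; rewrite leq_subRL; last first.
    by near: n; exact: nbhs_infty_ge.
  by near: n; exact: nbhs_infty_ge.
have p0 := lt0r_neq0 (qpochoo_gt0 hq q_lt1).
have -> : (qpochoo q q)^-1 = qpochoo q q * (qpochoo q q * qpochoo q q)^-1.
  by field.
have h : (fun N => qpoch q q N.*2.+1 * (qpoch q q (N + k).+1 * qpoch q q (N - k))^-1)
    @ \oo --> qpochoo q q * (qpochoo q q * qpochoo q q)^-1.
  apply: cvgM => //; apply: cvgV; first by rewrite mulf_neq0.
  exact: cvgM.
apply: cvg_trans h; apply: near_eq_cvg; near=> N.
have kN : (k <= N)%N by near: N; exact: nbhs_infty_ge.
have kN2 : ((N + k).+1 <= N.*2.+1)%N by rewrite ltnS -addnn leq_add2l.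
have := @gbin_qpoch R q _ _ kN2.
have -> : (N.*2.+1 - (N + k).+1 = N - k)%N by rewrite subSS -addnn subnDl.
move=> <-; rewrite mulfK// mulf_neq0// lt0r_neq0// qpoch_gt0//.
Unshelve. all: by end_near.
Qed.

Lemma fN_approx_le N x : Sq q x ->
  `|qpochoo q q * (semicircle q x * (weightPoly N).[x])| <=
  qpochoo q q * (Num.sqrt (1 - q) * 2 / (2 * pi) * expR (7 / (1 - `|q|))).
Proof.
have q_lt1 : `|q| < 1 by case/andP: (normq_lt1 hq).
move=> xS; have p0 := qpochoo_gt0 hq q_lt1.
rewrite normrM (gtr0_norm p0) ler_wpM2l// ?(ltW p0)// normrM ler_pM// ?normr_semicircle//.
rewrite horner_weightPoly big_add1/=.
apply: prod_near1_le; first exact: normq_lt1.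
move=> k; rewrite exprS; apply: normr_lq_factorB1 => //; exact: ltW.
Qed.

Lemma cvg_fN_approx x : Sq q x ->
  (fun N => qpochoo q q * (semicircle q x * (weightPoly N).[x])) @ \oo --> fN q x.
Proof.
move=> xS; have [W W0 hW] := cvg_lq_weight hq xS.
have -> : fN q x = qpochoo q q * (semicircle q x * W).
  by rewrite /fN (cvg_lim (@norm_hausdorff _ _) hW) /semicircle; ring.
apply: cvgMr; apply: cvgMr.
have -> : (fun N => (weightPoly N).[x]) = (fun N => \prod_(1 <= i < N.+1) lq q x (q ^+ i)).
  by apply/funext => N; rewrite horner_weightPoly.
by move: hW; rewrite -cvg_shiftS.
Qed.

Lemma bounded_weight_fN : bounded_weight (fN q).
Proof.
split; last first.
  eexists => x xS; apply: normr_cvg_le (cvg_fN_approx xS) _ => n.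
  exact: fN_approx_le.
apply: measurable_fun_cvg (fun x => @cvg_fN_approx x) => N.
apply: measurable_funM; first exact: measurable_cst.
exact: (measurable_wint bounded_weight_semicircle).
Qed.

Lemma fN_ge0 x : Sq q x -> 0 <= fN q x.
Proof.
have q_lt1 : `|q| < 1 by case/andP: (normq_lt1 hq).
move=> xS; have [W W0 hW] := cvg_lq_weight hq xS.
rewrite /fN (cvg_lim (@norm_hausdorff _ _) hW).
by rewrite !mulr_ge0 ?invr_ge0 ?mulr_ge0 ?pi_ge0 ?(ltW W0)// ltW// qpochoo_gt0.
Qed.

(** Bounded convergence, since the finite products are uniformly bounded on
    S(q) ([prod_near1_le]). *)
Lemma cvg_wint_fN p :
  (fun N => qpochoo q q * wint (semicircle q) (weightPoly N * p)) @ \oo --> wint (fN q) p.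
Proof.
have [M hM] := poly_bounded_Sq p.
have -> : (fun N => qpochoo q q * wint (semicircle q) (weightPoly N * p)) =
  (fun N => \int[mu]_(x in Sq q) (qpochoo q q * (semicircle q x * (weightPoly N).[x]) * p.[x])).
  apply/funext => N; rewrite -wintZ; last exact: bounded_weight_semicircle.
  by apply: eq_Rintegral => x _; rewrite !hornerM hornerC; ring.
apply: (@bounded_convergence _ _ _ mu _ measurable_Sq lebesgue_Sq_lty
  (fun N x => qpochoo q q * (semicircle q x * (weightPoly N).[x]) * p.[x])
  (fun x => fN q x * p.[x])
  (qpochoo q q * (Num.sqrt (1 - q) * 2 / (2 * pi) * expR (7 / (1 - `|q|))) * M)).
- move=> N; apply: measurable_funM.
    apply: measurable_funM; first exact: measurable_cst.
    exact: (measurable_wint bounded_weight_semicircle).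
  apply: measurable_funTS; apply: continuous_measurable_fun; exact: continuous_horner.
- by move=> n x xS; rewrite normrM ler_pM ?fN_approx_le ?hM.
- by move=> x xS; apply: cvgMl; exact: cvg_fN_approx.
Qed.

Lemma wint_fN_cheb_even k : wint (fN q) (cheb q k.*2) = (-1) ^+ k * q ^+ 'C(k.+1, 2).
Proof.
have q_lt1 : `|q| < 1 by case/andP: (normq_lt1 hq).
have h1 := @cvg_wint_fN (cheb q k.*2).
have h2 : (fun N => qpochoo q q * wint (semicircle q) (weightPoly N * cheb q k.*2)) @ \oo
    --> (-1) ^+ k * q ^+ 'C(k.+1, 2).
  have -> : (fun N => qpochoo q q * wint (semicircle q) (weightPoly N * cheb q k.*2)) =
      (fun N => qpochoo q q * ((-1) ^+ k * q ^+ 'C(k.+1, 2) * gbin q N.*2.+1 (N + k).+1)).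
    by apply/funext => N; rewrite finite_weight_cheb_even.
  rewrite -[X in _ --> X]mulr1 -(divff (lt0r_neq0 (qpochoo_gt0 hq q_lt1))) mulrCA.
  by apply: cvgMr; apply: cvgMr; exact: cvg_gbin_central.
exact: cvg_unique (@norm_hausdorff _ _) _ _ _ _ h1 h2.
Qed.

Lemma wint_fN_cheb_odd k : wint (fN q) (cheb q k.*2.+1) = 0.
Proof.
have h1 := @cvg_wint_fN (cheb q k.*2.+1).
have h2 : (fun N => qpochoo q q * wint (semicircle q) (weightPoly N * cheb q k.*2.+1)) @ \oo
    --> (0 : R).
  have -> : (fun N => qpochoo q q * wint (semicircle q) (weightPoly N * cheb q k.*2.+1)) =
      (fun N => 0).
    by apply/funext => N; rewrite finite_weight_cheb_odd mulr0.
  exact: cvg_cst.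
exact: cvg_unique (@norm_hausdorff _ _) _ _ _ _ h1 h2.
Qed.

End WeightedIntegral.

(** * Orthogonality of the q-Hermite polynomials *)

Section Orthogonality.
Variables (R : realType) (q : R).
Hypothesis hq : -1 < q < 1.
Let s := Num.sqrt (1 - q).

Fixpoint nHermitePoly (n : nat) : {poly R} :=
  match n with
  | 0%N => 1
  | m.+1 => s%:P * 'X * nHermitePoly m
            - (1 - q ^+ m)%:P * match m with 0%N => 0 | p.+1 => nHermitePoly p end
  end.

Lemma nHermitePoly0 : nHermitePoly 0 = 1. Proof. by []. Qed.

Lemma nHermitePoly1 : nHermitePoly 1 = s%:P * 'X.
Proof. by rewrite /= mulr0 subr0 mulr1. Qed.

Lemma nHermitePolyS n : nHermitePoly n.+2 =
  s%:P * 'X * nHermitePoly n.+1 - (1 - q ^+ n.+1)%:P * nHermitePoly n.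
Proof. by []. Qed.

Lemma horner_nHermitePoly n x : (nHermitePoly n).[x] = nHermite q x n.
Proof.
suff H m : (nHermitePoly m).[x] = nHermite q x m /\ (nHermitePoly m.+1).[x] = nHermite q x m.+1.
  by case: (H n).
elim: m => [|m [IH1 IH2]].
  by rewrite nHermitePoly0 nHermitePoly1 nHermite0 nHermite1 hornerM !hornerC hornerX.
split=> //; rewrite nHermitePolyS nHermiteS//.
by rewrite !(hornerD, hornerN) !hornerM !hornerC hornerX IH1 IH2.
Qed.

Let L p := wint q (fN q) p.
Let okN := bounded_weight_fN hq.

Let LZ c p : L (c%:P * p) = c * L p. Proof. exact: wintZ. Qed.
Let LB p1 p2 : L (p1 - p2) = L p1 - L p2. Proof. exact: wintB. Qed.
Let LD p1 p2 : L (p1 + p2) = L p1 + L p2. Proof. exact: wintD. Qed.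

Let b n m := L (nHermitePoly n * cheb q m).

Let bSS n m : b n.+2 m.+1 = b n.+1 m.+2 + b n.+1 m - (1 - q ^+ n.+1) * b n m.+1.
Proof.
rewrite -LZ -LD -LB /b nHermitePolyS chebS; congr L.
by move: (nHermitePoly n.+1) (nHermitePoly n) (cheb q m.+1) (cheb q m) => A B C D; ring.
Qed.

Let bS0 n : b n.+2 0 = b n.+1 1 - (1 - q ^+ n.+1) * b n 0.
Proof.
rewrite -LZ -LB /b nHermitePolyS cheb1 cheb0; congr L.
by move: (nHermitePoly n.+1) (nHermitePoly n) => A B; rewrite -/s; ring.
Qed.

Let b1S m : b 1 m.+1 = b 0 m.+2 + b 0 m.
Proof.
rewrite -LD /b nHermitePoly1 nHermitePoly0 chebS; congr L.
by move: (cheb q m.+1) (cheb q m) => A B; rewrite -/s; ring.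
Qed.

Let b10 : b 1 0 = b 0 1.
Proof. by rewrite /b nHermitePoly1 nHermitePoly0 cheb1 cheb0 -/s mulr1 mul1r. Qed.

Let bval n k : R := (-1) ^+ k * q ^+ 'C(k.+1, 2) * (qpoch q q (n + k) / qpoch q q k).

Let qp0 n : qpoch q q n != 0.
Proof. by rewrite lt0r_neq0// qpoch_gt0//; case/andP: (normq_lt1 hq). Qed.

Let bvalSS n k : bval n.+2 k = bval n.+1 k.+1 + bval n.+1 k - (1 - q ^+ n.+1) * bval n k.+1.
Proof.
rewrite /bval (_ : 'C(k.+2, 2) = ('C(k.+1, 2) + k.+1)%N); last by rewrite binS bin1.
move: 'C(k.+1, 2) => c; rewrite !addnS !addSn [(-1) ^+ k.+1]exprS.
rewrite ![qpoch q q (n + k).+2]qpochS ![qpoch q q (n + k).+1]qpochS ![qpoch q q k.+1]qpochS.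
rewrite ![q ^+ _.+1]exprS !exprD.
have h1 := qp0 k; have h2 : 1 - q * q ^+ k != 0.
  by have := qp0 k.+1; rewrite qpochS mulf_eq0 negb_or => /andP[].
by field; rewrite h1 h2.
Qed.

(** The integrals b n m of w h_n V_m satisfy
    b (n+2) m = b (n+1) (m+1) + b (n+1) (m-1) - (1 - q^(n+1)) b n m, because
    sqrt (1 - q) x can be attached to either polynomial. The closed form for
    m >= n propagates from n = 0; below the diagonal the terms vanish or, next
    to it, cancel. *)
Lemma wint_nHermitePoly_cheb n :
  [/\ forall k, L (nHermitePoly n * cheb q (n + k.*2)) = bval n k,
      forall k, L (nHermitePoly n * cheb q (n + k.*2.+1)) = 0 &
      forall m, (m < n)%N -> L (nHermitePoly n * cheb q m) = 0].
Proof.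
pose P n := [/\ forall k, b n (n + k.*2) = bval n k, forall k, b n (n + k.*2.+1) = 0 &
      forall m, (m < n)%N -> b n m = 0].
suff H m : P m /\ P m.+1 by case: (H n).
elim: m => [|m [IH1 IH2]].
  have P0e k : b 0 k.*2 = bval 0 k.
    by rewrite /b nHermitePoly0 mul1r /L wint_fN_cheb_even// /bval add0n divff ?mulr1.
  have P0o k : b 0 k.*2.+1 = 0.
    by rewrite /b nHermitePoly0 mul1r /L wint_fN_cheb_odd.
  split; first by split.
  split=> [k|k|].
  - rewrite add1n b1S -doubleS !P0e /bval.
    rewrite (_ : 'C(k.+2, 2) = ('C(k.+1, 2) + k.+1)%N); last by rewrite binS bin1.
    move: 'C(k.+1, 2) => c; rewrite !add0n add1n exprD [(-1) ^+ k.+1]exprS.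
    rewrite ![qpoch q q k.+1]qpochS ![q ^+ _.+1]exprS.
    have h1 := qp0 k; have h2 : 1 - q * q ^+ k != 0.
      by have := qp0 k.+1; rewrite qpochS mulf_eq0 negb_or => /andP[].
    by field; rewrite h1 h2.
  - by rewrite add1n b1S -doubleS !P0o addr0.
  - by case=> // _; rewrite b10 (P0o 0%N).
split=> //; case: IH1 IH2 => [e1 o1 z1] [e2 o2 z2]; split=> [k|k|].
- rewrite !addSn bSS bvalSS -e2 -e2 -e1 !doubleS !addSn !addnS//.
- by rewrite !addSn bSS; have := o2 k.+1; have := o2 k; have := o1 k.+1;
    rewrite !doubleS !addSn !addnS => -> -> ->; rewrite mulr0 subr0 addr0.
have diag i : bval i.+1 0 = (1 - q ^+ i.+1) * bval i 0.
  by rewrite /bval !addn0 qpochS -exprS; ring.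
have e10 := e1 0%N; have e20 := e2 0%N; rewrite double0 !addn0 in e10 e20.
have o10 := o1 0%N; have o20 := o2 0%N; rewrite double0 addn1 in o10; rewrite double0 addn1 in o20.
case=> [_|j jm].
  rewrite bS0; case: m e10 e20 z1 z2 {e1 e2 o1 o2 o10 o20} => [|m] e10 e20 z1 z2.
    by rewrite e10 e20 diag subrr.
  by rewrite z1// z2// mulr0 subr0.
rewrite bSS (z2 j)// addr0; move: jm; rewrite ltnS ltnS leq_eqVlt => /predU1P[->|].
  by rewrite o20 o10 mulr0 subr0.
rewrite leq_eqVlt => /predU1P[->|jm]; first by rewrite e10 e20 diag subrr.
by rewrite z2// z1// mulr0 subr0.
Qed.

Lemma wint_nHermitePoly n : L (nHermitePoly n) = (n == 0%N)%:R.
Proof.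
have [e _ z] := wint_nHermitePoly_cheb n.
case: n e z => [|n] e z; last by have := z 0%N isT; rewrite cheb0 mulr1.
have := e 0%N; rewrite double0 addn0 cheb0 mulr1 => ->.
by rewrite /bval addn0 qpoch0 bin_small// !expr0 divff ?mulr1.
Qed.

Let c n m := L (nHermitePoly n * nHermitePoly m).

Let cC n m : c n m = c m n. Proof. by rewrite /c mulrC. Qed.

Let cSS n m : c n.+1 m.+2 = c n.+2 m.+1 + (1 - q ^+ n.+1) * c n m.+1
  - (1 - q ^+ m.+1) * c n.+1 m.
Proof.
rewrite -!LZ -LD -LB /c !nHermitePolyS; congr L.
move: (nHermitePoly n.+1) (nHermitePoly n) (nHermitePoly m.+1) (nHermitePoly m) => A B C D; ring.
Qed.

Let cS1 n : c n.+1 1 = c n.+2 0 + (1 - q ^+ n.+1) * c n 0.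
Proof.
rewrite -!LZ -LD /c !nHermitePolyS nHermitePoly1 nHermitePoly0; congr L.
move: (nHermitePoly n.+1) (nHermitePoly n) => A B; ring.
Qed.

(** The same exchange of sqrt (1 - q) x between the two factors, with the
    integrals of w h_n alone as initial values. *)
Lemma nHermitePoly_orthogonal n m :
  L (nHermitePoly n * nHermitePoly m) = (n == m)%:R * qpoch q q n.
Proof.
rewrite -/(c n m).
have c0 k : c k 0 = (k == 0%N)%:R by rewrite /c nHermitePoly0 mulr1 wint_nHermitePoly.
have c1 k : c k 1 = (k == 1%N)%:R * qpoch q q 1.
  case: k => [|k]; first by rewrite cC c0 mul0r.
  rewrite cS1 !c0 add0r; case: k => [|k]; last by rewrite !mulr0 mul0r.
  by rewrite eqxx !mul1r qpochS qpoch0 expr0 expr1 !mulr1 mul1r.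
suff H k : forall n, c n k = (n == k)%:R * qpoch q q n /\
    c n k.+1 = (n == k.+1)%:R * qpoch q q n by case: (H m n).
elim: k => [|k IH] {}n.
  rewrite c0 c1; split; case: n => [|[|n]]//=; rewrite ?mul0r ?qpoch0 ?mul1r//.
have [_ h1] := IH n; split=> //; case: n {h1} => [|n].
  by rewrite cC c0 mul0r.
rewrite cSS (IH n.+2).2 (IH n).2 (IH n.+1).1 !eqSS.
have qpS i : qpoch q q i.+1 = qpoch q q i * (1 - q ^+ i.+1) by rewrite qpochS -exprS.
have [->|nk] := eqVneq n k.+1.
  by rewrite gtn_eqF//= [qpoch q q k.+2]qpS; ring.
by have [<-|_] := eqVneq n.+1 k; rewrite /= ?[qpoch q q n.+2]qpS; ring.
Qed.

End Orthogonality.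

(** * Composition and trace of Mehler kernels *)

Section KernelComposition.
Variables (R : realType) (q : R).
Hypothesis hq : -1 < q < 1.
Notation mu := (@lebesgue_measure R).
Implicit Types (x y z a b r : R).

Let okN := bounded_weight_fN hq.

(** Partial sums of the Mehler kernel as polynomials in one of the variables. *)
Definition mehlerPoly y a n : {poly R} :=
  \sum_(0 <= i < n) (a ^+ i / qpoch q q i * nHermite q y i)%:P * nHermitePoly q i.

Lemma horner_mehlerPoly x y a n :
  (mehlerPoly y a n).[x] = series (mehler_term q x y a) n.
Proof.
rewrite /mehlerPoly /series/= horner_sum; apply: eq_bigr => i _.
by rewrite hornerM hornerC horner_nHermitePoly// mehler_termE//; ring.
Qed.

Lemma wint_mehlerPoly y z a b n :
  wint q (fN q) (mehlerPoly y a n * mehlerPoly z b n) =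
  series (mehler_term q y z (a * b)) n.
Proof.
rewrite /mehlerPoly big_distrl/= wint_sum// /series/=; apply: eq_big_nat => i /andP[_ ilt].
rewrite -mulrA wintZ// big_distrr/= wint_sum//.
rewrite (bigD1_seq i) ?mem_index_iota ?iota_uniq//= big1; last first.
  by move=> j ji; rewrite mulrCA wintZ// nHermitePoly_orthogonal// eq_sym (negbTE ji) mul0r mulr0.
rewrite [nHermitePoly q i * _]mulrCA wintZ// nHermitePoly_orthogonal// eqxx mul1r addr0 mehler_termE// exprMn.
have h := lt0r_neq0 (qpochqq_gt0 hq i).
by field.
Qed.

Lemma series_mehler_bounded a : `|a| < 1 -> exists M : R,
  forall x y n, Sq q x -> Sq q y -> `|series (mehler_term q x y a) n| <= M.
Proof.
move=> a1; have a01 : 0 <= `|a| < 1 by rewrite normr_ge0.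
have [K [th [K0 hth hK]]] := mehler_term_le hq a01.
exists (K / (1 - th)) => x y n xS yS; apply: (normr_series_dominated hth) => k.
exact: hK.
Qed.

Lemma cvg_mehler x y a : Sq q x -> Sq q y -> `|a| < 1 ->
  series (mehler_term q x y a) @ \oo --> mehler q x y a.
Proof. by move=> *; exact: is_cvg_mehler. Qed.

Lemma mehlerC x y a : mehler q x y a = mehler q y x a.
Proof. by rewrite /mehler mehler_termC. Qed.

Lemma measurable_mehler d (T : measurableType d) (D : set T) (X Y : T -> R) a :
  `|a| < 1 -> (forall p, D p -> Sq q (X p)) -> (forall p, D p -> Sq q (Y p)) ->
  measurable_fun D X -> measurable_fun D Y ->
  measurable_fun D (fun p => mehler q (X p) (Y p) a).
Proof.
move=> a1 DX DY mX mY.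
have mpoly (f : T -> R) (p : {poly R}) : measurable_fun D f -> measurable_fun D (fun t => p.[f t]).
  move=> mf; apply: (@measurableT_comp _ _ _ _ _ _ (horner p) _ f) => //.
  by apply: continuous_measurable_fun; exact: continuous_horner.
apply: (@measurable_fun_cvg _ _ _ D (fun n p => series (mehler_term q (X p) (Y p) a) n)).
  move=> n; apply: measurable_sum => i.
  have -> : (fun p => mehler_term q (X p) (Y p) a i) =
     (fun p => a ^+ i / qpoch q q i * ((nHermitePoly q i).[X p] * (nHermitePoly q i).[Y p])).
    by apply/funext => p; rewrite mehler_termE// !horner_nHermitePoly.
  by apply: measurable_funM => //; apply: measurable_funM; exact: mpoly.
by move=> p Dp; apply: cvg_mehler => //; [exact: DX|exact: DY].
Qed.

Lemma measurable_fN d (T : measurableType d) (D : set T) (X : T -> R) :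
  (forall p, D p -> Sq q (X p)) -> measurable_fun D X ->
  measurable_fun D (fun p => fN q (X p)).
Proof.
move=> DX mX; apply: (@measurable_comp _ _ _ _ _ _ (Sq q) (fN q) D X) => //.
- exact: measurable_Sq.
- by move=> _ [p Dp <-]; exact: DX.
- by case: okN.
Qed.

(** For the partial sums this is orthogonality ([wint_mehlerPoly]); they are
    uniformly bounded on S(q), and bounded convergence gives the limit. *)
Lemma mehler_composition y z a b : Sq q y -> Sq q z -> `|a| < 1 -> `|b| < 1 ->
  (\int[mu]_(x in Sq q) (fN q x * (mehler q x y a * mehler q x z b))%:E =
   (mehler q y z (a * b))%:E)%E.
Proof.
move=> yS zS a1 b1.
have ab1 : `|a * b| < 1.
  by rewrite normrM (le_lt_trans _ a1)// ler_piMr// ltW.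
have [_ [M hM]] := okN.
have [A hA] := series_mehler_bounded a1; have [B hB] := series_mehler_bounded b1.
pose f n x := fN q x * (mehlerPoly y a n * mehlerPoly z b n).[x].
have fE n x : f n x = fN q x * (series (mehler_term q x y a) n * series (mehler_term q x z b) n).
  by rewrite /f hornerM !horner_mehlerPoly.
have fM n x : Sq q x -> `|f n x| <= M * (A * B).
  move=> xS; rewrite fE normrM; apply: ler_pM => //; first exact: hM.
  by rewrite normrM; apply: ler_pM; rewrite ?hA ?hB.
have fl x : Sq q x -> f ^~ x @ \oo --> fN q x * (mehler q x y a * mehler q x z b).
  move=> xS; have -> : f ^~ x = (fun n => fN q x * (series (mehler_term q x y a) n * series (mehler_term q x z b) n)).
    by apply/funext => n; rewrite fE.
  by apply: cvgMr; apply: cvgM; exact: cvg_mehler.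
have mf n : measurable_fun (Sq q) (f n) := measurable_wint okN _.
have h1 := @bounded_convergence _ _ _ mu _ (@measurable_Sq R q) (@lebesgue_Sq_lty R q) _ _ _ mf fM fl.
have h2 : (fun n => \int[mu]_(x in Sq q) f n x) @ \oo --> mehler q y z (a * b).
  have -> : (fun n => \int[mu]_(x in Sq q) f n x) = series (mehler_term q y z (a * b)).
    by apply/funext => n; rewrite -wint_mehlerPoly.
  exact: cvg_mehler.
have <- : \int[mu]_(x in Sq q) (fN q x * (mehler q x y a * mehler q x z b)) =
    mehler q y z (a * b) by exact: cvg_unique (@norm_hausdorff _ _) _ _ _ _ h1 h2.
rewrite /Rintegral fineK//; apply: integrable_fin_num; first exact: measurable_Sq.
apply: (@bounded_measurable_integrable _ _ _ mu _ (@measurable_Sq R q) (@lebesgue_Sq_lty R q) _ (M * (A * B))).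
  exact: measurable_fun_cvg mf fl.
by move=> x xS; apply: normr_cvg_le (fl x xS) _ => n; exact: fM.
Qed.

(** Each term r^n H_n^2 / [n]_q! integrates to r^n. *)
Lemma mehler_trace r : `|r| < 1 ->
  (\int[mu]_(z in Sq q) (fN q z * mehler q z z r)%:E = ((1 - r)^-1)%:E)%E.
Proof.
move=> r1; have [_ [M hM]] := okN; have [A hA] := series_mehler_bounded r1.
pose P n : {poly R} := \sum_(0 <= i < n) (r ^+ i / qpoch q q i)%:P * (nHermitePoly q i * nHermitePoly q i).
pose f n z := fN q z * (P n).[z].
have fE n z : f n z = fN q z * series (mehler_term q z z r) n.
  rewrite /f /P /series/= horner_sum; congr (_ * _); apply: eq_bigr => i _.
  by rewrite !hornerM hornerC horner_nHermitePoly// mehler_termE.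
have fM n z : Sq q z -> `|f n z| <= M * A.
  by move=> zS; rewrite fE normrM ler_pM ?hM ?hA.
have fl z : Sq q z -> f ^~ z @ \oo --> fN q z * mehler q z z r.
  move=> zS; have -> : f ^~ z = (fun n => fN q z * series (mehler_term q z z r) n).
    by apply/funext => n; rewrite fE.
  by apply: cvgMr; exact: cvg_mehler.
have mf n : measurable_fun (Sq q) (f n) := measurable_wint okN _.
have h1 := @bounded_convergence _ _ _ mu _ (@measurable_Sq R q) (@lebesgue_Sq_lty R q) _ _ _ mf fM fl.
have h2 : (fun n => \int[mu]_(x in Sq q) f n x) @ \oo --> (1 - r)^-1.
  have -> : (fun n => \int[mu]_(x in Sq q) f n x) = series (geometric 1 r).
    apply/funext => n; rewrite -/(wint q (fN q) (P n)) /P wint_sum// /series/=.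
    apply: eq_bigr => i _; rewrite wintZ// nHermitePoly_orthogonal// eqxx mul1r /geometric/= ?mul1r divfK//.
    by rewrite lt0r_neq0// qpochqq_gt0.
  by have := @cvg_geometric_series R 1 r r1; rewrite div1r.
have <- : \int[mu]_(z in Sq q) (fN q z * mehler q z z r) = (1 - r)^-1
  by exact: cvg_unique (@norm_hausdorff _ _) _ _ _ _ h1 h2.
rewrite /Rintegral fineK//; apply: integrable_fin_num; first exact: measurable_Sq.
apply: (@bounded_measurable_integrable _ _ _ mu _ (@measurable_Sq R q) (@lebesgue_Sq_lty R q) _ (M * A)).
  exact: measurable_fun_cvg mf fl.
by move=> x xS; apply: normr_cvg_le (fl x xS) _ => n; exact: fM.
Qed.

Lemma mehler_ge0 x y a : Sq q x -> Sq q y -> `|a| < 1 -> 0 <= mehler q x y a.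
Proof.
move=> xS yS a1; have a2 : `|a ^+ 2| < 1 by rewrite normrX exprn_ilt1.
have [l l0 hl] := cvg_omegaq_prod hq xS yS a1.
rewrite mehlerE// (cvg_lim (@norm_hausdorff _ _) hl).
by rewrite divr_ge0// ltW// qpochoo_gt0.
Qed.

End KernelComposition.

(** * Tonelli on rectangles and the marginals of the density *)

(** The integrand is extended by 0, so that measurability and positivity matter
    on the rectangle only; the infinite products in the density are controlled
    on S(q) alone. *)
Lemma tonelli_setX d1 d2 (T1 : measurableType d1) (T2 : measurableType d2)
    (R : realType) (m1 : {sigma_finite_measure set T1 -> \bar R})
    (m2 : {sigma_finite_measure set T2 -> \bar R})
    (A : set T1) (B : set T2) (f : T1 * T2 -> \bar R) :
  measurable A -> measurable B -> measurable_fun (A `*` B) f ->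
  (forall p, (A `*` B) p -> (0 <= f p)%E) ->
  (\int[m1 \x m2]_(p in A `*` B) f p =
   \int[m2]_(y in B) \int[m1]_(x in A) f (x, y))%E.
Proof.
move=> mA mB mf f0; rewrite integral_mkcond fubini_tonelli2; last 2 first.
- exact: (measurable_restrictT f (measurableX mA mB)).1 mf.
- by move=> p; rewrite patchE; case: ifPn => // /[!inE] /f0.
rewrite [RHS]integral_mkcond; apply: eq_integral => y _.
rewrite /fubini_G patchE; case: ifPn => [/[!inE] yB|yB].
  rewrite [RHS]integral_mkcond; apply: eq_integral => x _.
  rewrite !patchE; case: ifPn => [/[!inE] -[/= xA _]|xyAB]; first by rewrite mem_set.
  by case: ifPn => // /[!inE] xA; case/negP: xyAB; rewrite inE.
apply: integral0_eq => x _; rewrite patchE; case: ifPn => // /[!inE] -[_ /= yB'].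
by case/negP: yB; rewrite inE.
Qed.

Section ProductSigmaFinite.
Context d1 d2 (T1 : measurableType d1) (T2 : measurableType d2) (R : realType).
Variables (m1 : {sigma_finite_measure set T1 -> \bar R})
          (m2 : {sigma_finite_measure set T2 -> \bar R}).

Lemma sigma_finite_product : sigma_finite setT (m1 \x m2)%E.
Proof.
by case: (lebesgue_integral_fubini.measure_function_Measure_isSigmaFinite__to__measure_function_isSigmaFinite m1 m2).
Qed.

(** Needed to integrate over a threefold product, where the first factor is
    itself a product measure. *)
Definition product_sigma_finite_measure :=
  HB.pack_for {sigma_finite_measure set (T1 * T2)%type -> \bar R} (m1 \x m2)%E
    (Measure_isSigmaFinite.Build _ _ _ (m1 \x m2)%E sigma_finite_product).

End ProductSigmaFinite.

Section Marginals.
Variables (R : realType) (q : R).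
Hypothesis hq : -1 < q < 1.
Notation mu := (@lebesgue_measure R).
Notation S := (Sq q).
Notation TR := (measurableTypeR R).
Implicit Types (x y z a b c r : R).

Let mS : measurable (S : set TR). Proof. exact: measurable_Sq. Qed.

(** The density without its constant, in terms of Mehler kernels. *)
Definition chain3 a b c x y z : R :=
  fN q x * fN q y * fN q z * (mehler q x y a * mehler q x z b * mehler q y z c).

Section Fixed.
Variables a b c : R.
Hypotheses (a1 : `|a| < 1) (b1 : `|b| < 1) (c1 : `|c| < 1).

Lemma chain3_ge0 x y z : S x -> S y -> S z -> 0 <= chain3 a b c x y z.
Proof.
move=> xS yS zS; rewrite /chain3 mulr_ge0//.
  by rewrite mulr_ge0 ?fN_ge0// mulr_ge0 ?fN_ge0.
by rewrite mulr_ge0 ?mehler_ge0// mulr_ge0 ?mehler_ge0.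
Qed.

Lemma measurable_chain3 d (T : measurableType d) (D : set T) (X Y Z : T -> R) :
  (forall p, D p -> S (X p)) -> (forall p, D p -> S (Y p)) -> (forall p, D p -> S (Z p)) ->
  measurable_fun D X -> measurable_fun D Y -> measurable_fun D Z ->
  measurable_fun D (fun p => chain3 a b c (X p) (Y p) (Z p)).
Proof.
move=> DX DY DZ mX mY mZ; apply: measurable_funM.
  by apply: measurable_funM; [apply: measurable_funM|]; exact: measurable_fN.
by apply: measurable_funM; [apply: measurable_funM|]; exact: measurable_mehler.
Qed.

Lemma measurable_chain3_pair z : S z ->
  measurable_fun (T := (TR * TR)%type) (S `*` S)
    (fun p => (chain3 a b c p.1 p.2 z)%:E).
Proof.
move=> zS; apply/measurable_EFinP; apply: measurable_chain3 => //.
- by move=> p [].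
- by move=> p [].
- exact: (measurable_funTS (@measurable_fst _ _ TR TR)).
- exact: (measurable_funTS (@measurable_snd _ _ TR TR)).
Qed.

Lemma measurable_chain3_triple :
  measurable_fun (T := (TR * TR * TR)%type) ((S `*` S) `*` S)
    (fun p => (chain3 a b c p.1.1 p.1.2 p.2)%:E).
Proof.
apply/measurable_EFinP; apply: measurable_chain3.
- by move=> p [[]].
- by move=> p [[]].
- by move=> p [].
- apply: measurable_funTS.
  exact: (measurableT_comp (@measurable_fst _ _ TR TR) (@measurable_fst _ _ (TR * TR)%type TR)).
- apply: measurable_funTS.
  exact: (measurableT_comp (@measurable_snd _ _ TR TR) (@measurable_fst _ _ (TR * TR)%type TR)).
- exact: (measurable_funTS (@measurable_snd _ _ (TR * TR)%type TR)).
Qed.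

Lemma normr_mul_lt1 : `|a * b| < 1.
Proof. by rewrite normrM (le_lt_trans _ a1)// ler_piMr// ltW. Qed.

(** Composition in x gives P_ab(y, z), and composition in y with P_c(y, z)
    closes the cycle. *)
Lemma integral_chain3_pair z : S z ->
  (\int[mu \x mu]_(p in S `*` S) (chain3 a b c p.1 p.2 z)%:E =
   (fN q z * mehler q z z (a * b * c))%:E)%E.
Proof.
move=> zS; have mf := measurable_chain3_pair zS.
have f0 (p : R * R) : (S `*` S) p -> (0 <= (chain3 a b c p.1 p.2 z)%:E)%E.
  by move=> [p1 p2]; rewrite lee_fin chain3_ge0.
have inner y : S y -> (\int[mu]_(x in S) (chain3 a b c x y z)%:E =
    (fN q z)%:E * (fN q y * (mehler q y z (a * b) * mehler q y z c))%:E)%E.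
  move=> yS.
  transitivity (\int[mu]_(x in S) ((fN q y * fN q z * mehler q y z c)%:E *
      (fN q x * (mehler q x y a * mehler q x z b))%:E))%E.
    by apply: eq_integral => x _; rewrite /chain3 -EFinM; congr EFin; ring.
  rewrite ge0_integralZl_EFin//.
  - rewrite mehler_composition// -!EFinM; congr EFin; ring.
  - by move=> x xS; rewrite lee_fin mulr_ge0 ?fN_ge0// mulr_ge0 ?mehler_ge0.
  - apply/measurable_EFinP; apply: measurable_funM; first by apply: measurable_fN.
    by apply: measurable_funM; apply: measurable_mehler.
  - by rewrite mulr_ge0 ?mehler_ge0// mulr_ge0 ?fN_ge0.
transitivity (\int[mu]_(y in S) \int[mu]_(x in S) (chain3 a b c x y z)%:E)%E.
  exact: (@tonelli_setX _ _ TR TR R mu mu S S _ mS mS mf f0).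
transitivity (\int[mu]_(y in S) ((fN q z)%:E *
    (fN q y * (mehler q y z (a * b) * mehler q y z c))%:E))%E.
  by apply: eq_integral => y /[!inE] yS; rewrite -inner.
rewrite ge0_integralZl_EFin//.
- by rewrite mehler_composition ?normr_mul_lt1// -EFinM.
- by move=> x xS; rewrite lee_fin mulr_ge0 ?fN_ge0// mulr_ge0 ?mehler_ge0// normr_mul_lt1.
- apply/measurable_EFinP; apply: measurable_funM; first by apply: measurable_fN.
  by apply: measurable_funM; apply: measurable_mehler => //; exact: normr_mul_lt1.
- by rewrite fN_ge0.
Qed.

Lemma integral_chain3 :
  (\int[(mu \x mu) \x mu]_(p in (S `*` S) `*` S) (chain3 a b c p.1.1 p.1.2 p.2)%:E =
   ((1 - a * b * c)^-1)%:E)%E.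
Proof.
have f0 (p : TR * TR * TR) : ((S `*` S) `*` S) p ->
    (0 <= (chain3 a b c p.1.1 p.1.2 p.2)%:E)%E.
  by move=> [[p1 p2] p3]; rewrite lee_fin chain3_ge0.
transitivity (\int[mu]_(z in S) \int[mu \x mu]_(p in S `*` S) (chain3 a b c p.1 p.2 z)%:E)%E.
  exact: (@tonelli_setX _ _ (TR * TR)%type TR R
    (@product_sigma_finite_measure _ _ TR TR R mu mu) mu (S `*` S) S _
    (measurableX mS mS) mS measurable_chain3_triple f0).
transitivity (\int[mu]_(z in S) (fN q z * mehler q z z (a * b * c))%:E)%E.
  by apply: eq_integral => z /[!inE] zS; rewrite -integral_chain3_pair.
rewrite mehler_trace// normrM (le_lt_trans _ normr_mul_lt1)// ler_piMr// ltW//.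
Qed.

End Fixed.

Section Density.
Variables r12 r13 r23 : R.
Hypotheses (h12 : `|r12| < 1) (h13 : `|r13| < 1) (h23 : `|r23| < 1).
Let r := r12 * r13 * r23.

Lemma g3D_chain3 x y z : S x -> S y -> S z ->
  g3D q r12 r13 r23 x y z = chain3 r12 r13 r23 x y z.
Proof.
move=> xS yS zS; rewrite /g3D /chain3 !mehlerE//; congr (_ * _).
have [l1 l10 hl1] := cvg_omegaq_prod hq xS yS h12.
have [l2 l20 hl2] := cvg_omegaq_prod hq xS zS h13.
have [l3 l30 hl3] := cvg_omegaq_prod hq yS zS h23.
rewrite (cvg_lim (@norm_hausdorff _ _) hl1) (cvg_lim (@norm_hausdorff _ _) hl2).
rewrite (cvg_lim (@norm_hausdorff _ _) hl3).
have -> : \big[*%R/1]_(0 <= i <oo) (omegaq q x y (r12 * q ^+ i)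
    * omegaq q x z (r13 * q ^+ i) * omegaq q y z (r23 * q ^+ i)) = l1 * l2 * l3.
  apply: cvg_lim => //.
  have -> : (fun n => \prod_(0 <= i < n) (omegaq q x y (r12 * q ^+ i)
      * omegaq q x z (r13 * q ^+ i) * omegaq q y z (r23 * q ^+ i))) =
    (fun n => (\prod_(0 <= i < n) omegaq q x y (r12 * q ^+ i)) *
      (\prod_(0 <= i < n) omegaq q x z (r13 * q ^+ i)) *
      (\prod_(0 <= i < n) omegaq q y z (r23 * q ^+ i))).
    by apply/funext => n; rewrite !big_split.
  by apply: cvgM => //; exact: cvgM.
have := lt0r_neq0 l10; have := lt0r_neq0 l20; have := lt0r_neq0 l30 => n3 n2 n1.
by field; rewrite n1 n2 n3.
Qed.

Lemma normalizing_constant : C3D q r12 r13 r23 = 1 - r.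
Proof.
rewrite -[1 - r]invrK -[(1 - r)^-1]/(fine ((1 - r)^-1)%:E) -integral_chain3//.
congr (fine _)^-1; apply: eq_integral => p /[!inE] -[[p1 p2] p3].
by rewrite g3D_chain3.
Qed.

Lemma normr_mul3_lt1 : `|r| < 1.
Proof.
rewrite /r normrM (le_lt_trans _ (normr_mul_lt1 h12 h13))//; by rewrite ler_piMr// ltW.
Qed.

(** The three marginals differ by a permutation of the variables only, and the
    product of the three correlations is the same for all of them. *)
Lemma integral_marginal a b c z (f : R * R -> R) :
  `|a| < 1 -> `|b| < 1 -> `|c| < 1 -> a * b * c = r -> S z ->
  (forall p, (S `*` S) p -> f p = C3D q r12 r13 r23 * chain3 a b c p.1 p.2 z) ->
  (\int[mu \x mu]_(p in S `*` S) (f p)%:E = (form_squares q r z)%:E)%E.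
Proof.
move=> a1 b1 c1 abc zS hf.
transitivity (\int[mu \x mu]_(p in S `*` S) ((1 - r)%:E * (chain3 a b c p.1 p.2 z)%:E))%E.
  by apply: eq_integral => p /[!inE] pS; rewrite hf// normalizing_constant -EFinM.
rewrite ge0_integralZl_EFin//.
- rewrite integral_chain3_pair// abc -EFinM; congr EFin.
  by rewrite /form_squares sqHermite_termE mulrA.
- exact: measurableX.
- by move=> p [p1 p2]; rewrite lee_fin chain3_ge0.
- exact: measurable_chain3_pair.
- by rewrite subr_ge0 ltW// (le_lt_trans (ler_norm _) normr_mul3_lt1).
Qed.

Lemma fZ_form_squares z : S z -> fZ q r12 r13 r23 z = (form_squares q r z)%:E.
Proof.
move=> zS; apply: (integral_marginal h12 h13 h23) => // p [p1 p2].
by rewrite /f3D g3D_chain3.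
Qed.

Lemma fY_form_squares y : S y -> fY q r12 r13 r23 y = (form_squares q r y)%:E.
Proof.
move=> yS; apply: (integral_marginal h13 h12 h23) => //; first by rewrite /r; ring.
move=> p [p1 p2]; rewrite /f3D g3D_chain3// /chain3 (mehlerC _ y).
by congr (_ * _); ring.
Qed.

Lemma fX_form_squares x : S x -> fX q r12 r13 r23 x = (form_squares q r x)%:E.
Proof.
move=> xS; apply: (integral_marginal h23 h12 h13) => //; first by rewrite /r; ring.
move=> p [p1 p2]; rewrite /f3D g3D_chain3// /chain3.
by rewrite (mehlerC _ x p.1) (mehlerC _ x p.2); congr (_ * _); ring.
Qed.

End Density.
End Marginals.

Theorem proposition1 (R : realType) (q r12 r13 r23 : R)
  (hq : -1 < q < 1) (h12 : -1 < r12 < 1) (h13 : -1 < r13 < 1)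
  (h23 : -1 < r23 < 1) (r : R) (hr : r = r12 * r13 * r23)
  (z : R) (hz : Sq q z) :
  [/\ cvgn (series (sqHermite_term q r z)) &
      cvgn (series (evenHermite_term q r z))] /\
  [/\ fZ q r12 r13 r23 z = (form_squares q r z)%:E,
      fY q r12 r13 r23 z = (form_squares q r z)%:E &
      fX q r12 r13 r23 z = (form_squares q r z)%:E] /\
  [/\ form_squares q r z = form_conditional q r z,
      form_conditional q r z = form_product q r z,
      form_product q r z = form_even q r z &
      form_even q r z = form_explicit q r z].
Proof.
rewrite -ltr_norml in h12; rewrite -ltr_norml in h13; rewrite -ltr_norml in h23.
have r1 : `|r| < 1 by rewrite hr; exact: normr_mul3_lt1.
have e1 := form_squares_conditional hq hz r1.
have e2 := form_conditional_product hq hz r1.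
have e3 := form_squares_even hq hz r1.
have e4 := form_product_explicit hq hz r1.
split; last split.
- by split; [rewrite sqHermite_termE; exact: is_cvg_mehler|exact: is_cvg_evenHermite].
- by rewrite hr; split; [exact: fZ_form_squares|exact: fY_form_squares|exact: fX_form_squares].
- by split=> //; [rewrite -e2 -e1|rewrite -e3 e1 e2].
Qed.
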